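(* Let $p$ be a prime and $\alpha\ge 1$ an integer, and let $G=(\mathbb{Z}_p)^\alpha$ act on $\mathbb{R}^k$ by orthogonal linear transformations. Suppose $X\subset \mathbb{S}^{k-1}$ is an orbit of this action. Let $d\ge 1$ and $n\ge d(|G|-1)+k$. Then for every continuous map $f\colon \mathbb{S}^{n-1}\to\mathbb{R}^d$ there is an isometric copy $X'\subset \mathbb{S}^{n-1}$ of $X$ (a subset $X'$ of $\mathbb{S}^{n-1}$ together with a distance-preserving bijection $X\to X'$) such that $f$ is constant on $X'$.
   Context: $\mathbb{S}^{m-1}$ denotes the unit sphere in $\mathbb{R}^m$, and $\mathbb{Z}_p$ the cyclic group of order $p$. Distances are Euclidean. *)

(* Defs.v *)
From HB Require Import structures.
From mathcomp Require Import all_boot all_order all_algebra.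
From mathcomp Require Import all_classical all_reals topology normedtype.
Set Implicit Arguments. Unset Strict Implicit. Unset Printing Implicit Defensive.
Import Order.TTheory GRing.Theory Num.Theory.
Local Open Scope ring_scope.
Local Open Scope classical_set_scope.

Definition euclid_norm (R : realType) (m : nat) (x : 'cV[R]_m) : R :=
  Num.sqrt (\sum_(i < m) x i 0 ^+ 2).

Definition euclid_dist (R : realType) (m : nat) (x y : 'cV[R]_m) : R :=
  euclid_norm (x - y).

Definition sphere (R : realType) (m : nat) : set 'cV[R]_m :=
  [set x | euclid_norm x = 1].

Definition orthogonal_mx (R : realType) (m : nat) (A : 'M[R]_m) : Prop :=
  A *m A^T = 1%:M.

Definition orth_action (R : realType) (m : nat) (G : zmodType)
  (rho : G -> 'M[R]_m) : Prop :=
  rho 0 = 1%:M /\ (forall g h, rho (g + h) = rho g *m rho h) /\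
  (forall g, orthogonal_mx (rho g)).

Definition orbit_of (R : realType) (m : nat) (G : zmodType)
  (rho : G -> 'M[R]_m) (x : 'cV[R]_m) : set 'cV[R]_m :=
  [set rho g *m x | g in [set: G]].

(* Main.v *)
(** Let [F = 'F_p], [G = F^alpha], [N = d (|G| - 1)].  If no linear isometry
    [U : R^k -> R^n] makes [g |-> f (U (rho g) x0)] constant, then by Fourier
    inversion on [G] each [U] has a hyperplane of [G], given by a character
    [chi], and a coordinate of [f] for which the [p] sums over the cosets of
    that hyperplane are not all equal.  Labelling [U] by a coset with maximal
    sum gives, for each pair (hyperplane, coordinate), a [chi]-equivariant
    label in [F]; the number of pairs times [p - 1] is at most [N].  The
    Vandermonde product is a translation invariant cocycle on tuples in [F]
    that vanishes unless all labels occur, so the cup product of its pullbacks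
    is an invariant cocycle on tuples of isometries that vanishes on tuples of
    small diameter.

    On the other hand, since [n >= N + k], generic [n x k] matrices [A_0, ...,
    A_N] are such that all convex combinations of [A_0 rho(g_0), ...,
    A_N rho(g_N)] have full rank.  Polar decomposition then maps these
    simplices equivariantly to isometries, and iterated barycentric
    subdivision makes them small.  As tuples in [G] admit only one equivariant
    chain map up to homotopy, the cup product of the [chi]^* of the Vandermonde
    cocycle would be an invariant coboundary on [G].  This is the Euler class
    of the reduced regular representation to the power [d]: evaluating it on a
    cross product of explicit cycles for the [alpha] coordinate axes gives a
    nonzero element of [F]. *)

Require Import Defs.
From HB Require Import structures.
From mathcomp Require Import all_boot all_order all_algebra.
From mathcomp Require Import all_classical all_reals topology normedtype.
From mathcomp Require Import sequences derive ring lra zify.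
Set Implicit Arguments. Unset Strict Implicit. Unset Printing Implicit Defensive.
Import Order.TTheory GRing.Theory Num.Theory numFieldNormedType.Exports.
Local Open Scope ring_scope.

(** * Cochains on finite sequences and cone operators *)

Section Cochains.
Variable F : comNzRingType.

(** Cochains of all degrees are kept together as one function on sequences of vertices, and the
    recursion unfolds to the alternating sum over faces. The complex is augmented: on a single
    vertex the coboundary of [phi] is [phi [::]]. *)
Fixpoint cobd (P : Type) (phi : seq P -> F) (s : seq P) : F :=
  if s is x :: s' then phi s' - cobd (fun t => phi (x :: t)) s' else 0.

Lemma cobd_cons (P : Type) (phi : seq P -> F) x s :
  cobd phi (x :: s) = phi s - cobd (fun t => phi (x :: t)) s.
Proof. by []. Qed.

Lemma eq_cobd_size (P : Type) (phi psi : seq P -> F) n s :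
  (forall t, size t = n -> phi t = psi t) -> size s = n.+1 ->
  cobd phi s = cobd psi s.
Proof.
elim: s n phi psi => [|x s IHs] n phi psi //= Epsi [sz_s].
rewrite Epsi //; congr (_ - _).
case: n => [|n] in Epsi sz_s *; first by rewrite (size0nil sz_s).
by apply: (IHs n) => // t sz_t; apply: Epsi; rewrite /= sz_t.
Qed.

Lemma eq_cobd (P : Type) (phi psi : seq P -> F) s :
  phi =1 psi -> cobd phi s = cobd psi s.
Proof.
by case: s => [|x s] // E; apply: (@eq_cobd_size _ _ _ (size s)) => // t _.
Qed.

Lemma cobd0 (P : Type) (s : seq P) : cobd (fun=> 0) s = 0.
Proof. by elim: s => //= x s ->; rewrite subr0. Qed.

Lemma cobdD (P : Type) (phi psi : seq P -> F) s :
  cobd (fun t => phi t + psi t) s = cobd phi s + cobd psi s.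
Proof. by elim: s phi psi => [|x s IHs] phi psi /=; rewrite ?addr0 // IHs; ring. Qed.

Lemma cobdZ (P : Type) a (phi : seq P -> F) s :
  cobd (fun t => a * phi t) s = a * cobd phi s.
Proof. by elim: s phi => [|x s IHs] phi /=; rewrite ?mulr0 // IHs; ring. Qed.

Lemma cobdB (P : Type) (phi psi : seq P -> F) s :
  cobd (fun t => phi t - psi t) s = cobd phi s - cobd psi s.
Proof.
have := cobdD phi (fun t => (-1) * psi t) s; rewrite cobdZ mulN1r => <-.
by apply: eq_cobd => t; rewrite mulN1r.
Qed.

Lemma cobd_cobd (P : Type) (phi : seq P -> F) s : cobd (cobd phi) s = 0.
Proof.
elim: s phi => [|x s IHs] phi //=.
by rewrite cobdB IHs; ring.
Qed.

Lemma cobd_map (P Q : Type) (h : Q -> P) (phi : seq P -> F) s :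
  cobd phi (map h s) = cobd (fun t => phi (map h t)) s.
Proof. by elim: s phi => [|x s IHs] phi //=; rewrite IHs. Qed.

Lemma cobd_exchange (P Q : Type) (Phi : seq P -> seq Q -> F) a b :
  cobd (fun a' => cobd (Phi a') b) a = cobd (fun b' => cobd (Phi^~ b') a) b.
Proof.
elim: a Phi => [|x a IHa] Phi /=; first by rewrite cobd0.
by rewrite IHa -cobdB.
Qed.

(* Dual of the chain map built by coning: the simplex [t] is sent to the cone
   with apex [b t] over the image of its boundary. *)
Fixpoint cone_rec (T P : Type) (b : seq T -> P) n (phi : seq P -> F) (t : seq T) : F :=
  if n is n'.+1 then cobd (cone_rec b n' (fun s => phi (b t :: s))) t else phi [::].

Definition cone_op (T P : Type) (b : seq T -> P) phi t := cone_rec b (size t) phi t.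

Section ConeOp.
Variables (T P : Type) (b : seq T -> P).
Local Notation C := (cone_op b).

Lemma cone_op_nil phi : C phi [::] = phi [::].
Proof. by []. Qed.

Lemma cone_op_cons phi x t :
  C phi (x :: t) = cobd (C (fun s => phi (b (x :: t) :: s))) (x :: t).
Proof.
apply: (@eq_cobd_size _ (cone_rec b (size t) (fun s => phi (b (x :: t) :: s)))
  _ (size t)) => // u sz_u.
by rewrite /cone_op sz_u.
Qed.

Lemma cone_opB phi psi t : C (fun s => phi s - psi s) t = C phi t - C psi t.
Proof.
rewrite /cone_op; move: (size t) => n.
elim: n t phi psi => [|n IHn] t phi psi //=.
by rewrite -cobdB; apply: eq_cobd => u; apply: IHn.
Qed.

(** The boundary of a cone is its base minus the cone over the boundary of the base. Here the base
    is itself a boundary, so the second term becomes a double coboundary. *)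
Lemma cone_op_cobd phi t : C (cobd phi) t = cobd (C phi) t.
Proof.
have [n] := ubnP (size t); elim: n t phi => // n IHn [|x t] phi //= lt_tn.
rewrite cone_op_cons; set q := b _.
have E u : C (fun s => cobd phi (q :: s)) u =
    C phi u - C (cobd (fun r => phi (q :: r))) u by apply: cone_opB.
rewrite (eq_cobd _ E) cobdB.
rewrite (@eq_cobd_size _ (C (cobd _)) (cobd (C (fun r => phi (q :: r)))) (size t)) //.
  by rewrite cobd_cobd subr0.
by move=> u sz_u; apply: IHn; rewrite sz_u.
Qed.

End ConeOp.

(* Two chain maps with acyclic target are homotopic: [D] is the difference of
   their duals, and the homotopy is built by coning from the base point [q]. *)
Section Homotopy.
Variables (T P : Type) (D : (seq P -> F) -> seq T -> F).
Hypothesis D_sub : forall phi psi t,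
  D (fun s => phi s - psi s) t = D phi t - D psi t.
Hypothesis D_cobd : forall phi t, D (cobd phi) t = cobd (D phi) t.
Hypothesis D_nil : forall phi, D phi [::] = 0.
Variable q : T -> P.

Fixpoint htpy_rec n (phi : seq P -> F) (t : seq T) : F :=
  if n is n'.+1 then
    if t is x :: _ then
      let phi' s := phi (q x :: s) in D phi' t - cobd (htpy_rec n' phi') t
    else 0
  else 0.

Definition htpy phi t := htpy_rec (size t) phi t.

Lemma htpy_cons phi x t (phi' := fun s => phi (q x :: s)) :
  htpy phi (x :: t) = D phi' (x :: t) - cobd (htpy phi') (x :: t).
Proof.
rewrite /htpy; transitivity (D phi' (x :: t) - cobd (htpy_rec (size t) phi') (x :: t)) => //.
congr (_ - _); apply: (@eq_cobd_size _ _ _ (size t)) => // u sz_u.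
by rewrite sz_u.
Qed.

Lemma htpyB phi psi t : htpy (fun s => phi s - psi s) t = htpy phi t - htpy psi t.
Proof.
rewrite /htpy; move: (size t) => n.
elim: n t phi psi => [|n IHn] [|x t] phi psi; rewrite ?subr0 //.
rewrite /htpy_rec -/htpy_rec D_sub.
under eq_cobd do rewrite IHn.
by rewrite cobdB; ring.
Qed.

Lemma htpyP phi t : D phi t = cobd (htpy phi) t + htpy (cobd phi) t.
Proof.
have [n] := ubnP (size t); elim: n t phi => // n IHn [|x t] phi lt_tn.
  by rewrite D_nil addr0.
rewrite htpy_cons; set phi' := fun s => phi (q x :: s).
have ->: D (fun s => cobd phi (q x :: s)) (x :: t) =
  D phi (x :: t) - D (cobd phi') (x :: t) by rewrite -D_sub.
have E1 u : htpy (fun s => cobd phi (q x :: s)) u = htpy phi u - htpy (cobd phi') u.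
  by rewrite -htpyB.
(* On faces, the induction hypothesis for [phi'] turns [htpy (cobd phi')] into [D phi'] minus a
   coboundary, which the outer coboundary kills. *)
have E2 : cobd (htpy (cobd phi')) (x :: t) = D (cobd phi') (x :: t).
  rewrite D_cobd -[RHS]subr0 -[X in _ - X](cobd_cobd (htpy phi') (x :: t)) -cobdB.
  apply: (@eq_cobd_size _ _ _ (size t)) => // u sz_u.
  by rewrite IHn ?sz_u // addrC addKr.
by rewrite (eq_cobd _ E1) cobdB E2; ring.
Qed.
End Homotopy.

End Cochains.

(** * Cup products and the Vandermonde cocycle *)

Section Cup.
Variables (F : comNzRingType) (P : Type).
Implicit Types (u v phi : seq P -> F) (s : seq P).

Definition cup m u v s := u (take m.+1 s) * v (drop m s).

Definition cocycle n phi := forall s, size s = n.+2 -> cobd phi s = 0.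

Lemma cobd_cup m n u v s : size s = (m + n).+2 ->
  cobd (cup m u v) s =
  cobd u (take m.+2 s) * v (drop m.+1 s) +
  (-1) ^+ m * (u (take m.+1 s) * cobd v (drop m s)).
Proof.
elim: m n u s => [|m IHm] n u [|x s] //.
  case: s => [|y s] //= _; rewrite /cup /= !take0 expr0 mul1r.
  rewrite cobdZ [cobd _ [::]]/=; ring.
move=> [sz_s]; rewrite [LHS]/= (@eq_cobd _ _ _ (cup m (fun t => u (x :: t)) v)) //.
rewrite (IHm n) //= /cup /= exprS; ring.
Qed.

Lemma cup_cocycle m n u v :
  cocycle m u -> cocycle n v -> cocycle (m + n) (cup m u v).
Proof.
move=> cu cv s sz_s; rewrite (cobd_cup _ _ sz_s).
rewrite cu ?cv ?size_takel ?size_drop ?sz_s ?mul0r ?mulr0 ?addr0 //; lia.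
Qed.

End Cup.

Section Vandermonde.
Variable F : comNzRingType.
Implicit Types (s : seq F) (x y : F).

Fixpoint vdm s := if s is x :: s' then (\prod_(y <- s') (y - x)) * vdm s' else 1.

Lemma vdm_det n s : size s = n -> vdm s = \det (\matrix_(i < n, j < n) s`_i ^+ j).
Proof.
move=> sz_s; transitivity (\det (Vandermonde n (\row_(i < n) s`_i))); last first.
  by rewrite -det_tr; congr (\det _); apply/matrixP=> i j; rewrite !mxE.
rewrite det_Vandermonde; elim: s n sz_s => [|x s IHs] n /= <-; first by rewrite big_ord0.
rewrite big_ord_recl (IHs _ erefl); congr (_ * _).
  rewrite [RHS]big_mkcond big_ord_recl /= mul1r (big_nth 0) big_mkord.
  by apply: eq_bigr => i _; rewrite !mxE.
apply: eq_bigr => i _; rewrite [RHS]big_mkcond big_ord_recl /= mul1r.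
rewrite big_mkcond; apply: eq_bigr => j _; rewrite !mxE /= /bump !leq0n !add1n ltnS.
by case: ifP.
Qed.

Lemma cobd_index (P : Type) (phi : seq P -> F) t :
  cobd phi t = \sum_(i < size t) (-1) ^+ i * phi (take i t ++ drop i.+1 t).
Proof.
elim: t phi => [|x t IHt] phi /=; first by rewrite big_ord0.
rewrite big_ord_recl /= expr0 mul1r drop0 IHt; congr (_ + _).
by rewrite -sumrN; apply: eq_bigr => i _; rewrite /= /bump add1n exprS; ring.
Qed.

Lemma vdm_cocycle n : cocycle n vdm.
Proof.
move=> s sz_s; rewrite cobd_index.
(* The exponent [j.-1] makes columns 0 and 1 both constant 1, so the determinant vanishes; its
   expansion along column 0 is the alternating sum of the Vandermonde determinants of the faces. *)
pose A := \matrix_(i < n.+2, j < n.+2) s`_i ^+ j.-1 : 'M[F]_n.+2.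
have detA : \det A = 0.
  rewrite -det_tr; apply: (@determinant_alternate _ _ _ ord0 (lift ord0 ord0)) => //.
  by move=> j; rewrite !mxE.
rewrite -[RHS]detA (expand_det_col _ ord0) sz_s; apply: eq_bigr => i _.
rewrite mxE expr0 mul1r /cofactor addn0; congr (_ * _).
have lt_i : (i < n.+2)%N := ltn_ord i.
have sz_d : size (take i s ++ drop i.+1 s) = n.+1.
  by rewrite size_cat size_takel ?size_drop ?sz_s //; lia.
rewrite (vdm_det sz_d); congr (\det _); apply/matrixP=> i' j; rewrite !mxE /=.
congr (_ ^+ _); rewrite nth_cat size_takel ?sz_s; last lia.
rewrite /bump; have [lt_i'i | le_ii'] := ltnP i' i.
  by rewrite nth_take.
by rewrite nth_drop; congr (s`__); lia.
Qed.

Lemma vdm_repeat s : ~~ uniq s -> vdm s = 0.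
Proof.
elim: s => [|x s IHs] //=; rewrite negb_and negbK => /orP[x_s|/IHs->].
  by rewrite (big_rem x) //= subrr !mul0r.
by rewrite mulr0.
Qed.

Lemma vdm_shift a s : vdm [seq a + x | x <- s] = vdm s.
Proof.
elim: s => [|x s IHs] //=; rewrite {}IHs big_map; congr (_ * _).
by apply: eq_bigr => y _; ring.
Qed.

End Vandermonde.

(** * Cycles for the cyclic group of prime order *)

Lemma vdm_perm_sq (F : comNzRingType) (s t : seq F) :
  perm_eq s t -> vdm s ^+ 2 = vdm t ^+ 2.
Proof.
have vdm_rem (x : F) r : x \in r ->
    vdm r ^+ 2 = (\prod_(y <- rem x r) (y - x)) ^+ 2 * vdm (rem x r) ^+ 2.
  elim: r => [|z r IHr] //; rewrite inE [rem _ _]/=.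
  case: eqVneq => [->|neq_xz] /=; first by rewrite exprMn.
  move=> x_r.
  rewrite exprMn (IHr x_r) (big_rem x) //= big_cons; ring.
elim: s t => [|x s IHs] t eq_st.
  by move: eq_st; rewrite perm_sym => /perm_nilP->.
have x_t : x \in t by rewrite -(perm_mem eq_st) mem_head.
rewrite (vdm_rem x t x_t) /= exprMn; congr (_ * _).
  congr (_ ^+ 2); apply: perm_big.
  by rewrite -(perm_cons x) (perm_trans eq_st) // perm_to_rem.
by apply: IHs; rewrite -(perm_cons x) (perm_trans eq_st) ?perm_to_rem.
Qed.

Section ListSums.
Variables (F : finComNzRingType).
Implicit Types (f W theta : seq F -> F).

Fixpoint lsum n f : F :=
  if n is n'.+1 then \sum_(x : F) lsum n' (fun s => f (x :: s)) else f [::].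

Lemma eq_lsum n f g : (forall s, size s = n -> f s = g s) -> lsum n f = lsum n g.
Proof.
elim: n f g => [|n IHn] f g E /=; first exact: E.
by apply: eq_bigr => x _; apply: IHn => s sz_s; apply: E; rewrite /= sz_s.
Qed.

Lemma lsumD n f g : lsum n (fun s => f s + g s) = lsum n f + lsum n g.
Proof.
by elim: n f g => [|n IHn] f g //=; rewrite -big_split; apply: eq_bigr => x _; apply: IHn.
Qed.

Lemma lsumZ n a f : lsum n (fun s => a * f s) = a * lsum n f.
Proof.
by elim: n f => [|n IHn] f //=; rewrite big_distrr; apply: eq_bigr => x _; apply: IHn.
Qed.

Lemma lsumB n f g : lsum n (fun s => f s - g s) = lsum n f - lsum n g.
Proof.
rewrite -mulN1r -lsumZ -lsumD; apply: eq_lsum => s _.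
by rewrite mulN1r.
Qed.

Lemma lsum_sum (I : finType) n (f : I -> seq F -> F) :
  lsum n (fun s => \sum_i f i s) = \sum_i lsum n (f i).
Proof.
elim: n f => [|n IHn] f //=; rewrite exchange_big; apply: eq_bigr => x _ /=.
exact: IHn.
Qed.

Lemma lsum_cat m n f : lsum (m + n) f = lsum m (fun s => lsum n (fun t => f (s ++ t))).
Proof.
by elim: m f => [|m IHm] f //=; apply: eq_bigr => x _; apply: IHm.
Qed.

Lemma lsum_shift n a f : lsum n (fun s => f [seq a + x | x <- s]) = lsum n f.
Proof.
elim: n f => [|n IHn] f //=; rewrite [RHS](reindex (+%R a)) /=.
  by apply: eq_bigr => x _; rewrite -(IHn (fun s => f (a + x :: s))).
by exists (+%R (- a)) => x _; rewrite ?addKr ?addNKr.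
Qed.

Lemma lsum_perm n c s : uniq s -> size s = n ->
  lsum n (fun t => if perm_eq t s then c else 0) = c *+ n`!.
Proof.
elim: n s => [|n IHn] s /=; first by move=> _ /size0nil->; rewrite perm_refl.
move=> Us sz_s.
rewrite (eq_bigr (fun x => if x \in s then c *+ n`! else 0)); last first.
  move=> x _; case: ifPn => x_s.
    rewrite -(IHn (rem x s)) ?rem_uniq ?size_rem ?sz_s //.
    apply: eq_lsum => t _; congr (if _ then _ else _).
    by rewrite (permPr (perm_to_rem x_s)) perm_cons.
  rewrite -[RHS](mul0r (lsum n (fun=> 0))) -lsumZ; apply: eq_lsum => t _.
  case: ifP => [/perm_mem/(_ x)|]; last by rewrite mul0r.
  by rewrite mem_head (negbTE x_s).
rewrite -big_mkcond -big_uniq //= big_const_seq count_predT sz_s iter_addr_0.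
by rewrite -mulrnA factS mulnC.
Qed.

(** The condition is imposed on every variable in turn, the other variables being fixed. *)
Fixpoint null_marginals n W : Prop :=
  if n is n'.+1 then
    (forall s, size s = n' -> \sum_(x : F) W (x :: s) = 0) /\
    (forall x, null_marginals n' (fun s => W (x :: s)))
  else True.

Lemma eq_null_marginals n W W' :
  (forall s, size s = n -> W s = W' s) -> null_marginals n W -> null_marginals n W'.
Proof.
elim: n W W' => [|n IHn] W W' E //= [W0 W1]; split=> [s sz_s|x].
  by rewrite -[RHS](W0 s sz_s); apply: eq_bigr => x _; rewrite E //= sz_s.
by apply: IHn (W1 x) => s sz_s; rewrite E //= sz_s.
Qed.

Lemma null_marginalsZ n a W : null_marginals n W -> null_marginals n (fun s => a * W s).
Proof.
elim: n W => [|n IHn] W //= [W0 W1]; split=> [s sz_s|x]; last exact: IHn.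
by rewrite -big_distrr /= W0 ?mulr0.
Qed.

Lemma null_marginals_cat m n U W : null_marginals m U -> null_marginals n W ->
  null_marginals (m + n) (fun s => U (take m s) * W (drop m s)).
Proof.
move=> U0 W0; elim: m U U0 => [|m IHm] U /=.
  move=> _; apply: eq_null_marginals (null_marginalsZ (U [::]) W0).
  by move=> s _; rewrite take0 drop0.
move=> [U0 U1]; split=> [s sz_s|x]; last first.
  exact: (IHm (fun s => U (x :: s)) (U1 x)).
by rewrite -big_distrl /= U0 ?mul0r ?size_takel // sz_s leq_addr.
Qed.

(** Each face omits one vertex, and summing the weight over the omitted vertex gives zero. *)
Lemma lsum_null_cobd n W theta : null_marginals n W ->
  lsum n (fun s => W s * cobd theta s) = 0.
Proof.
elim: n W theta => [|n IHn] W theta /=; first by rewrite mulr0.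
move=> [W0 W1].
rewrite (eq_bigr (fun x => lsum n (fun s => W (x :: s) * theta s))).
  rewrite -lsum_sum -[RHS](mul0r (lsum n (fun=> 0))) -lsumZ; apply: eq_lsum => s sz_s.
  by rewrite -big_distrl /= W0 ?mul0r.
move=> x _; rewrite -[RHS]subr0 -(IHn _ (fun s => theta (x :: s)) (W1 x)) -lsumB.
by apply: eq_lsum => s _; rewrite mulrBr.
Qed.

End ListSums.

Section PrimeField.
Variable p : nat.
Hypothesis p_pr : prime p.
Local Notation F := 'F_p.

Let cardF : #|F| = p. Proof. exact: card_Fp. Qed.

Lemma natr_Fp_eq0 n : (n%:R == 0 :> F) = (p %| n)%N.
Proof. by rewrite -(dvdn_pcharf (pchar_Fp p_pr)). Qed.

Lemma sum_expr_Fp k : (k < p.-1)%N -> \sum_(x : F) x ^+ k = 0.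
Proof.
move=> lt_kp; case: k lt_kp => [_|k lt_kp].
  by rewrite sumr_const card_Fp //; apply/eqP; rewrite natr_Fp_eq0.
(* Otherwise X^(k+1) - 1 would have p - 1 roots, more than its degree. Scaling by [a] permutes the
   field and multiplies the sum by a factor other than 1. *)
have [a a0 ak]: exists2 a : F, a != 0 & a ^+ k.+1 != 1.
  apply/exists_inP; apply: contraLR lt_kp; rewrite negb_exists_in => /forall_inP all1.
  have <-: #|predC1 (0 : F)| = p.-1 by rewrite cardC1 cardF.
  rewrite -leqNgt cardE -ltnS.
  have <-: size ('X^(k.+1) - 1 : {poly F}) = k.+2 by rewrite -polyC1 size_XnsubC.
  apply: max_poly_roots.
  - by rewrite -size_poly_gt0 -polyC1 size_XnsubC.
  - apply/allP => a; rewrite mem_enum inE => a0.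
    by rewrite rootE !hornerE subr_eq0 -[_ == _]negbK all1.
  - exact: enum_uniq.
have: (a ^+ k.+1 - 1) * \sum_(x : F) x ^+ k.+1 = 0.
  rewrite mulrBl mul1r {2}(reindex (fun x => a * x)) /=; last first.
    by exists (fun x => a^-1 * x) => x _; rewrite ?mulKf ?mulVKf.
  by rewrite big_distrr -sumrB big1 // => x _; rewrite exprMn subrr.
by move/eqP; rewrite mulf_eq0 subr_eq0 (negbTE ak) => /eqP.
Qed.

Lemma sum_horner_Fp (P : {poly F}) : (size P < p)%N -> \sum_(x : F) P.[x] = 0.
Proof.
move=> sz_P; under eq_bigr do rewrite horner_coef.
rewrite exchange_big big1 //= => i _; rewrite -big_distrr /= sum_expr_Fp ?mulr0 //.
by have lt_i : (i < size P)%N := ltn_ord i; lia.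
Qed.

Let leq_pred2 m n : (m <= n)%N -> (m.-1 <= n.-1)%N.
Proof. lia. Qed.

(** The factor [P] is there for the induction: fixing the first variable [x] replaces [P] by P (X -
    x), trading one variable for one degree. The bound keeps the first marginal in the range of
    [sum_horner_Fp]. *)
Lemma vdm_null_marginals n (P : {poly F}) : (size P + n <= p)%N ->
  null_marginals n (fun s => (\prod_(y <- s) P.[y]) * vdm s).
Proof.
elim: n P => [|n IHn] P //= le_p; split=> [s sz_s|x].
  pose Q := P * \prod_(y <- s) (y%:P - 'X).
  rewrite (eq_bigr (fun x => (\prod_(y <- s) P.[y] * vdm s) * Q.[x])).
    rewrite -big_distrr /= sum_horner_Fp ?mulr0 //.
    apply: leq_ltn_trans (size_polyMleq _ _) _.
    suff le_n : (size (\prod_(y <- s) (y%:P - 'X))%R <= n.+1)%N.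
      apply: (@leq_ltn_trans (size P + n.+1).-1); first by rewrite leq_pred2 // leq_add2l.
      by move: le_p; rewrite addnS.
    rewrite -sz_s; elim: (s) => [|y r IHr]; first by rewrite big_nil size_poly1.
    rewrite big_cons; apply: leq_trans (size_polyMleq _ _) _.
    by rewrite -opprB size_polyN size_XsubC; exact: IHr.
  move=> x _; rewrite big_cons /Q hornerM horner_prod.
  have -> : \prod_(y <- s) (y%:P - 'X).[x] = \prod_(y <- s) (y - x).
    by apply: eq_bigr => y _; rewrite !hornerE.
  ring.
apply: (@eq_null_marginals _ _ (fun s => P.[x] *
    ((\prod_(y <- s) (P * ('X - x%:P)).[y]) * vdm s))).
  move=> s _; rewrite big_cons (eq_bigr (fun y => P.[y] * (y - x))).
    rewrite big_split /=; ring.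
  by move=> y _; rewrite !hornerE.
apply/null_marginalsZ/IHn; apply: leq_trans le_p.
rewrite addnS -addSn leq_add2r.
by apply: leq_trans (size_polyMleq _ _) _; rewrite size_XsubC addn2.
Qed.

(* [vdm] has degree [p - 2] in each of its [p - 1] variables, hence zero marginals
   over ['F_p]: all faces but the first drop out of the boundary of the cycle
   below, and the first one does by translation invariance. *)
Fixpoint weight M (s : seq F) : F :=
  if M is M'.+1 then vdm (take p.-1 s) * weight M' (drop p.-1 s) else 1.

Lemma weight_null_marginals M : null_marginals (M * p.-1) (weight M).
Proof.
elim: M => [|M IHM] //=; rewrite mulSn.
apply: null_marginals_cat IHM.
apply: (@eq_null_marginals _ _ (fun s => (\prod_(y <- s) (1 : {poly F}).[y]) * vdm s)).
  by move=> s _; rewrite big1 ?mul1r // => y _; rewrite hornerE.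
by apply: vdm_null_marginals; rewrite size_poly1 add1n prednK ?prime_gt0.
Qed.

Lemma weight_shift M a s : weight M [seq a + x | x <- s] = weight M s.
Proof.
by elim: M s => [|M IHM] s //=; rewrite -map_take -map_drop vdm_shift IHM.
Qed.

(** Pairing with the chain of all simplices [0 :: b] weighted by [weight M b]. For positive [M] this
    chain is a cycle of dimension M (p - 1) once translates are identified. *)
Definition zcyc M (eta : seq F -> F) : F :=
  lsum (M * p.-1) (fun b => weight M b * eta (0 :: b)).

Lemma zcyc_cobd M eta : (0 < M)%N ->
  (forall a s, eta [seq a + x | x <- s] = eta s) -> zcyc M (cobd eta) = 0.
Proof.
move=> M_gt0 eta_inv; rewrite /zcyc.
have -> : lsum (M * p.-1) (fun b => weight M b * cobd eta (0 :: b)) =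
    lsum (M * p.-1) (fun b => weight M b * eta b) -
    lsum (M * p.-1) (fun b => weight M b * cobd (fun t => eta (0 :: t)) b).
  by rewrite -lsumB; apply: eq_lsum => s _; rewrite mulrBr.
rewrite lsum_null_cobd ?subr0; last exact: weight_null_marginals.
set H := fun b => weight M b * eta b.
have H_inv a s : H [seq a + x | x <- s] = H s by rewrite /H weight_shift eta_inv.
case def_n: (M * p.-1)%N => [|n]; first by move/eqP: def_n (prime_gt1 p_pr); rewrite muln_eq0; lia.
(* The face omitting 0: by translation invariance the sum over the first remaining vertex consists
   of [p] equal terms. *)
rewrite /= (eq_bigr (fun=> lsum n (fun s => H (0 :: s)))).
  by rewrite sumr_const card_Fp // -mulr_natr (eqP (_ : p%:R == 0)) ?mulr0 ?natr_Fp_eq0.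
move=> x _; rewrite -(lsum_shift _ x); apply: eq_lsum => s _.
by rewrite -(H_inv x (0 :: s)) /= addr0.
Qed.

(** The value of the Vandermonde cocycle of degree p - 1 on the cycle [zcyc 1]. *)
Definition kappa : F := lsum p.-1 (fun s => vdm s * vdm (0 :: s)).

Lemma kappa_shift l : lsum p.-1 (fun s => vdm s * vdm (l :: s)) = kappa.
Proof.
rewrite /kappa -[LHS](lsum_shift _ l); apply: eq_lsum => s _.
by rewrite vdm_shift -(vdm_shift l (0 :: s)) /= addr0.
Qed.

(** Only the orderings of the nonzero elements contribute. Each gives the same nonzero term, because
    the square of a Vandermonde product is symmetric, and their number (p - 1)! is prime to p. *)
Lemma kappa_neq0 : kappa != 0.
Proof.
pose t : seq F := enum (predC1 0).
have Ut : uniq t by apply: enum_uniq.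
have sz_t : size t = p.-1 by rewrite -cardE cardC1 cardF.
pose c := (\prod_(y <- t) y) * vdm t ^+ 2.
have ->: kappa = c *+ (p.-1)`!.
  rewrite -(lsum_perm c Ut sz_t); apply: eq_lsum => s sz_s /=.
  case: ifPn => [st|].
    rewrite /c -(perm_big _ st) -(vdm_perm_sq st).
    under eq_bigr do rewrite subr0.
    ring.
  have [Us|/vdm_repeat->] := boolP (uniq s); last by rewrite mul0r.
  have [s0 _|s0] := boolP (0 \in s).
    by rewrite (big_rem 0) //= subrr !mul0r mulr0.
  have sub_st : {subset s <= t}.
    by move=> y y_s; rewrite mem_enum inE; apply: contraNneq s0 => <-.
  have [|_ eq_st] := uniq_min_size Us sub_st; first by rewrite sz_s sz_t.
  by case/negP; apply: uniq_perm.
rewrite -mulr_natr mulf_neq0 //; last first.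
  have p_gt1 := prime_gt1 p_pr.
  rewrite natr_Fp_eq0; have: (p.-1 < p)%N by rewrite prednK ?prime_gt0.
  elim: (p.-1) => [|n IHn] lt_np; first by rewrite gtnNdvd.
  by rewrite factS Euclid_dvdM // negb_or gtnNdvd //= IHn // ltnW.
rewrite mulf_neq0 ?expf_neq0 //.
  by rewrite prodf_seq_neq0; apply/allP => x; rewrite mem_enum inE.
elim: (t) Ut => [|x r IHr] /=; first by [].
case/andP=> x_r Ur; rewrite mulf_neq0 ?IHr // prodf_seq_neq0.
by apply/allP => y y_r /=; rewrite subr_eq0; apply: contraNneq x_r => <-.
Qed.

Section CupLabels.
Variable P : Type.

(** Cup product of the pullbacks of the Vandermonde cocycle along the labels, each factor of degree
    p - 1. *)
Fixpoint cup_labels (L : seq (P -> F)) : seq P -> F :=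
  if L is l :: L' then cup p.-1 (fun s => vdm (map l s)) (cup_labels L') else fun=> 1.

Lemma cup_labels_cocycle L : cocycle (size L * p.-1) (cup_labels L).
Proof.
elim: L => [|l L IHL] /=.
  by case=> [|x [|y [|]]] //= _; rewrite subr0 subrr.
rewrite mulSn; apply: cup_cocycle IHL => s sz_s.
rewrite -(cobd_map l (@vdm F)); apply: (@vdm_cocycle _ p.-1).
by rewrite size_map.
Qed.

Lemma cup_labels_cat L1 L2 s :
  cup_labels (L1 ++ L2) s = cup (size L1 * p.-1) (cup_labels L1) (cup_labels L2) s.
Proof.
elim: L1 s => [|l L IHL] s /=; first by rewrite /cup mul1r drop0.
rewrite /cup IHL /cup take_takel; last by rewrite mulSn ltnS leq_addr.
rewrite mulSn drop_drop mulrA [in RHS]addnC -addSn -take_drop addnC; ring.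
Qed.

End CupLabels.

Lemma zcyc_cup_labels M : zcyc M (cup_labels (nseq M id)) = kappa ^+ M.
Proof.
(* The base vertex is generalised because, once the first block is split off, the remaining simplex
   starts at the last vertex of that block. *)
rewrite /zcyc; move: 0 => x0.
elim: M x0 => [|M IHM] x0; first by rewrite /= mulr1.
rewrite mulSn lsum_cat exprSr -[X in _ * X](kappa_shift x0) -lsumZ.
apply: eq_lsum => s sz_s; have Es : p = (size s).+1 by rewrite sz_s prednK ?prime_gt0.
rewrite -(IHM (last x0 s)) mulrC -[in RHS]lsumZ; apply: eq_lsum => t _.
rewrite /= /cup map_id take_size_cat // drop_size_cat //.
have -> : take p.-1.+1 (x0 :: s ++ t) = x0 :: s by rewrite /= take_size_cat.
have -> : drop p.-1 (x0 :: s ++ t) = last x0 s :: t.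
  rewrite -cat_cons lastI cat_rcons drop_size_cat // size_belast sz_s //.
rewrite [vdm (x0 :: s)]/=; ring.
Qed.

End PrimeField.

(** * Cross products *)

Section CrossProduct.
Variables (F : comNzRingType) (G : zmodType).
Implicit Types (phi psi : seq G -> F) (a b : seq G).

(** The coboundary without augmentation, for which the product formula [xprod_ncobd] holds. *)
Definition ncobd (T : Type) (phi : seq T -> F) s :=
  if (size s <= 1)%N then 0 else cobd phi s.

Definition bicobd (Phi : seq G -> seq G -> F) a b :=
  cobd (Phi^~ b) a + (-1) ^+ (size a).-1 * cobd (Phi a) b.

Fixpoint xprod_rec n phi a b : F :=
  if n isn't n'.+1 then 0 else
  match a, b with
  | [:: x], _ => phi [seq x + y | y <- b]
  | _, [:: y] => phi [seq x + y | x <- a]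
  | x :: _, y :: _ => bicobd (xprod_rec n' (fun s => phi (x + y :: s))) a b
  | _, _ => 0
  end.

(* Dual of the simplicial cross product of [a] and [b], embedded in [G] by
   addition, where the boundary of [a x b] is coned off from its first vertex. *)
Definition xprod phi a b := xprod_rec (size a + size b) phi a b.

Lemma eq_bicobd Phi Psi a b :
  (forall a' b', ((size a').+1 = size a /\ b' = b) \/ (a' = a /\ (size b').+1 = size b) ->
    Phi a' b' = Psi a' b') -> bicobd Phi a b = bicobd Psi a b.
Proof.
move=> E; congr (_ + _ * _).
  case: a E => [|x a] // E; apply: (@eq_cobd_size _ _ _ _ (size a)) => // a' sz_a'.
  by apply: E; left; rewrite sz_a'.
case: b E => [|y b] // E; apply: (@eq_cobd_size _ _ _ _ (size b)) => // b' sz_b'.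
by apply: E; right; rewrite sz_b'.
Qed.

Lemma bicobdB Phi Psi a b :
  bicobd (fun a' b' => Phi a' b' - Psi a' b') a b = bicobd Phi a b - bicobd Psi a b.
Proof. by rewrite /bicobd !cobdB; ring. Qed.

Lemma bicobdZ c Phi a b :
  bicobd (fun a' b' => c * Phi a' b') a b = c * bicobd Phi a b.
Proof. by rewrite /bicobd !cobdZ; ring. Qed.

Lemma xprod1l phi x b : xprod phi [:: x] b = phi [seq x + y | y <- b].
Proof. by []. Qed.

Lemma xprod1r phi x a y : xprod phi (x :: a) [:: y] = phi [seq z + y | z <- x :: a].
Proof. by case: a. Qed.

Lemma xprod_bicobd phi x a y b : (0 < size a)%N -> (0 < size b)%N ->
  xprod phi (x :: a) (y :: b) =
  bicobd (xprod (fun s => phi (x + y :: s))) (x :: a) (y :: b).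
Proof.
case: a b => [|x' a] [|y' b] // _ _.
apply: eq_bicobd => u v H; have E : (size u + size v)%N = ((size a).+1 + (size b).+2)%N.
  by case: H => [[/= [->] ->]|[-> /= [->]]] /=; lia.
by rewrite /xprod E.
Qed.

Lemma eq_xprod phi psi a b :
  (forall s, size s = (size a + size b).-1 -> phi s = psi s) ->
  xprod phi a b = xprod psi a b.
Proof.
rewrite /xprod; have [n def_n] : exists n, n = (size a + size b)%N by exists (size a + size b)%N.
rewrite -def_n; elim: n a b phi psi def_n => [|n IHn] a b phi psi def_n E //.
case: a def_n => [|x [|x' a]] def_n.
- by case: b def_n => [|y [|y' b]] // def_n; apply: E; case: def_n => ->.
- by apply: E; rewrite size_map; case: def_n => ->.
case: b def_n => [|y [|y' b]] def_n; first by [].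
  by apply: E; rewrite size_map; case: def_n => ->; rewrite addn1.
apply: eq_bicobd => u v H.
have sz_uv : n = (size u + size v)%N.
  by move: def_n; case: H => [[/= [->] ->]|[-> /= [->]]] /=; lia.
apply: IHn => // s sz_s; apply: E; rewrite /= sz_s.
by move: def_n; rewrite /=; lia.
Qed.

Lemma xprodB phi psi a b :
  xprod (fun s => phi s - psi s) a b = xprod phi a b - xprod psi a b.
Proof.
rewrite /xprod; move: (size a + size b)%N => n.
elim: n a b phi psi => [|n IHn] a b phi psi; first by rewrite subr0.
case: a => [|x [|x' a]]; case: b => [|y [|y' b]]; rewrite /= ?subr0 //.
rewrite -[LHS]/(bicobd (xprod_rec n (fun s => phi (x + y :: s) - psi (x + y :: s))) _ _).
by rewrite -bicobdB; apply: eq_bicobd => u v _; apply: IHn.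
Qed.

Lemma xprodZ c phi a b : xprod (fun s => c * phi s) a b = c * xprod phi a b.
Proof.
rewrite /xprod; move: (size a + size b)%N => n.
elim: n a b phi => [|n IHn] a b phi; first by rewrite mulr0.
case: a => [|x [|x' a]]; case: b => [|y [|y' b]]; rewrite /= ?mulr0 //.
rewrite -[LHS]/(bicobd (xprod_rec n (fun s => c * phi (x + y :: s))) _ _).
by rewrite -bicobdZ; apply: eq_bicobd => u v _; apply: IHn.
Qed.

Lemma xprod0 a b : xprod (fun=> 0) a b = 0.
Proof.
rewrite -[RHS](subrr (xprod (fun=> 0) a b)) -xprodB.
by apply: eq_xprod => s _; rewrite subrr.
Qed.

(** Every simplex of the coned cross product has first vertex [x + y]. *)
Lemma xprod_head phi x a y b :
  (forall s, phi (x + y :: s) = 0) -> xprod phi (x :: a) (y :: b) = 0.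
Proof.
move=> phi0; case: a => [|x' a]; first by rewrite xprod1l /= phi0.
case: b => [|y' b]; first by rewrite xprod1r /= phi0.
rewrite xprod_bicobd // -[RHS](xprod0 (x :: x' :: a) (y :: y' :: b)) xprod_bicobd //.
by apply: eq_bicobd => u v _; apply: eq_xprod => s _; apply: phi0.
Qed.

Lemma bicobd_mapl (h : G -> G) Phi a b :
  bicobd Phi (map h a) b = bicobd (fun a' => Phi (map h a')) a b.
Proof. by rewrite /bicobd cobd_map size_map. Qed.

Lemma bicobd_mapr (h : G -> G) Phi a b :
  bicobd Phi a (map h b) = bicobd (fun a' b' => Phi a' (map h b')) a b.
Proof. by rewrite /bicobd cobd_map. Qed.

Lemma xprod_shiftl g phi a b : (0 < size a)%N -> (0 < size b)%N ->
  xprod phi [seq g + x | x <- a] b = xprod (fun s => phi [seq g + x | x <- s]) a b.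
Proof.
have [n] := ubnP (size a + size b); elim: n a b phi => // n IHn [|x a] [|y b] //= phi lt_n _ _.
case: a lt_n => [|x' a] lt_n.
  by rewrite !xprod1l -map_comp; congr phi; apply: eq_map => z /=; rewrite addrA.
case: b lt_n => [|y' b] lt_n.
  rewrite !xprod1r -!map_comp; congr phi.
  by rewrite -!map_cons -map_comp; apply: eq_map => z /=; rewrite addrA.
rewrite !xprod_bicobd // -!map_cons bicobd_mapl.
apply: eq_bicobd => u v H; rewrite IHn.
- by apply: eq_xprod => s _ /=; rewrite addrA.
- by move: lt_n; case: H => [[/= [->] ->]|[-> /= [->]]] /=; lia.
- by case: H => [[/= [E1] E2]|[E1 /= [E2]]]; rewrite ?E1 ?E2.
by case: H => [[/= [E1] E2]|[E1 /= [E2]]]; rewrite ?E1 ?E2.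
Qed.

Lemma xprod_shiftr g phi a b : (0 < size a)%N -> (0 < size b)%N ->
  xprod phi a [seq g + x | x <- b] = xprod (fun s => phi [seq g + x | x <- s]) a b.
Proof.
have [n] := ubnP (size a + size b); elim: n a b phi => // n IHn [|x a] [|y b] //= phi lt_n _ _.
case: a lt_n => [|x' a] lt_n.
  rewrite !xprod1l -map_cons -!map_comp; congr phi.
  by apply: eq_map => z /=; rewrite addrCA.
case: b lt_n => [|y' b] lt_n.
  rewrite !xprod1r -!map_comp; congr phi.
  by apply: eq_map => z /=; rewrite addrCA.
rewrite !xprod_bicobd // -?map_cons ?bicobd_mapr // ?size_map //.
apply: eq_bicobd => u v H; rewrite IHn.
- by apply: eq_xprod => s _ /=; rewrite addrCA.
- by move: lt_n; case: H => [[/= [->] ->]|[-> /= [->]]] /=; lia.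
- by case: H => [[/= [E1] E2]|[E1 /= [E2]]]; rewrite ?E1 ?E2.
by case: H => [[/= [E1] E2]|[E1 /= [E2]]]; rewrite ?E1 ?E2.
Qed.

Lemma cobd_ncobd (T : Type) (phi : seq T -> F) s : (1 < size s)%N ->
  cobd (ncobd phi) s = 0.
Proof.
case: s => [|x [|y [|z s]]] // _; first by rewrite /= /ncobd /= !subrr.
rewrite -[RHS](cobd_cobd phi [:: x, y, z & s]).
by apply: (@eq_cobd_size _ _ _ _ (size s).+2) => // t sz_t; rewrite /ncobd sz_t.
Qed.

Lemma bicobd_bicobd Phi a b : (1 < size a)%N -> (1 < size b)%N ->
  bicobd (fun a' b' => ncobd (Phi^~ b') a' +
    (-1) ^+ (size a').-1 * ncobd (Phi a') b') a b = 0.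
Proof.
move=> a_gt1 b_gt1; rewrite /bicobd !cobdD cobd_ncobd // add0r cobdZ cobd_ncobd //.
rewrite mulr0 addr0 (@eq_cobd_size _ _ _ (fun a' =>
  (-1) ^+ (size a).-2 * cobd (Phi a') b) (size a).-1); first last.
- by rewrite prednK // ltnW.
- by move=> t ->; rewrite /ncobd leqNgt b_gt1.
rewrite cobdZ cobd_exchange.
rewrite (@eq_cobd_size _ _ (fun b' => ncobd (Phi^~ b') a)
  (fun b' => cobd (Phi^~ b') a) (size b).-1); first last.
- by rewrite prednK // ltnW.
- by move=> t _; rewrite /ncobd leqNgt a_gt1.
have -> : (size a).-1 = (size a).-2.+1 by lia.
by rewrite exprS; ring.
Qed.

(** The cross product is a chain map. As in [cone_op_cobd], the boundary of the cone is the boundary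
    of the cell minus a cone over its double boundary, and the latter vanishes by
    [bicobd_bicobd]. *)
Lemma xprod_ncobd phi a b : (0 < size a)%N -> (0 < size b)%N ->
  xprod (ncobd phi) a b =
  ncobd (fun a' => xprod phi a' b) a + (-1) ^+ (size a).-1 * ncobd (xprod phi a) b.
Proof.
have [n] := ubnP (size a + size b); elim: n a b phi => // n IHn [|x a] [|y b] //= phi lt_n _ _.
case: a lt_n => [|x' a] lt_n.
  rewrite [X in _ = X + _](_ : _ = 0) // add0r expr0 mul1r xprod1l /ncobd size_map.
  by case: ifP => // _; rewrite cobd_map.
case: b lt_n => [|y' b] lt_n.
  rewrite [X in _ = _ + _ * X](_ : _ = 0) // mulr0 addr0 xprod1r /ncobd size_map.
  rewrite cobd_map; apply: (@eq_cobd_size _ _ _ _ (size a).+1) => // -[|z t] // _.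
  by rewrite xprod1r.
rewrite xprod_bicobd //; set q := x + y; set phi' := fun s => phi (q :: s).
set A := [:: x, x' & a]; set B := [:: y, y' & b].
transitivity (bicobd (fun a' b' => xprod phi a' b' - xprod (ncobd phi') a' b') A B).
  apply: eq_bicobd => u v H; rewrite -xprodB; apply: eq_xprod => s sz_s.
  have sz_s2: (1 < size s)%N.
    by rewrite sz_s; case: H => [[/= [->] ->]|[-> /= [->]]] /=; lia.
  by rewrite /ncobd /= ltnS leqNgt (ltnW sz_s2) leqNgt sz_s2.
rewrite bicobdB -[RHS]subr0; congr (_ - _).
transitivity (bicobd (fun a' b' => ncobd (fun a'' => xprod phi' a'' b') a' +
    (-1) ^+ (size a').-1 * ncobd (xprod phi' a') b') A B).
  apply: eq_bicobd => u v H; apply: IHn.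
  - by move: lt_n; case: H => [[/= [->] ->]|[-> /= [->]]] /=; lia.
  - by case: H => [[/= [E1] E2]|[E1 /= [E2]]]; rewrite ?E1 ?E2.
  by case: H => [[/= [E1] E2]|[E1 /= [E2]]]; rewrite ?E1 ?E2.
exact: bicobd_bicobd.
Qed.

End CrossProduct.

Section CupXprod.
Variables (F : comNzRingType) (G : zmodType) (R : rel G).

(** [R] relates vertices that [u] cannot tell apart, and moves along [b] stay in one class. A move
    along [b] among the first [m] steps is thus killed by [u]; what remains is the simplex running
    first through [a] and then through [b]. *)
Lemma xprod_cup m (u v : seq G -> F) a b :
  (forall s t, all2 R s t -> u s = u t) ->
  (forall s1 x y s2, (size (s1 ++ x :: y :: s2) <= m.+1)%N -> R x y ->
     u (s1 ++ x :: y :: s2) = 0) ->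
  (forall x, R x x) ->
  (forall x y y', y \in 0 :: b -> y' \in 0 :: b -> R (x + y) (x + y')) ->
  size a = m.+1 -> (0 < size b)%N ->
  xprod (cup m u v) a b = u a * v [seq last 0 a + y | y <- b].
Proof.
move=> + + Rxx; elim: m u a b => [|m IHm] u [|x a] b //= uR u0 Rb [sz_a].
  rewrite (size0nil sz_a) xprod1l; case: b Rb => [|y b] //= Rb _.
  rewrite /cup /= take0; congr (_ * _); apply: uR; rewrite /= andbT.
  by rewrite -[X in R _ X]addr0 Rb ?inE ?eqxx ?orbT.
case: a sz_a => [|x' a] // sz_a; case: b Rb => [|y b] // Rb _.
have [/size0nil b_nil|b_gt0] := posnP (size b).
  rewrite b_nil xprod1r /cup take_oversize ?size_map //; last by case: sz_a => /= ->.
  congr (_ * v _).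
    apply: uR; move: (x :: _) => s; elim: s => //= z s ->.
    by rewrite andbT -[X in R _ X]addr0 Rb ?inE ?eqxx ?orbT.
  rewrite -map_drop lastI -cats1 drop_size_cat ?size_belast //.
rewrite xprod_bicobd // /bicobd.
set q := x + y; set phi := fun s => cup m.+1 u v (q :: s).
have phi0 x1 s : R q x1 -> phi (x1 :: s) = 0.
  move=> Rq; rewrite /phi /cup /=.
  rewrite -[q :: _]/([::] ++ q :: x1 :: take m s) u0 ?mul0r //=.
  by rewrite size_take_min !ltnS geq_minl.
have Rq : R q q by [].
(* Faces in the [b] direction: omitting the first vertex of [b] leads to a vertex related to [q],
   and all other faces still start at [q]. *)
rewrite [X in _ + _ * X](_ : _ = 0) ?mulr0 ?addr0; last first.
  case: b b_gt0 Rb @phi phi0 => [|y' b] // _ Rb phi phi0.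
  rewrite cobd_cons xprod_head ?sub0r => [|s]; last first.
    by apply: phi0; apply: Rb; rewrite !inE eqxx ?orbT.
  rewrite -[RHS]oppr0; congr (- _).
  rewrite -[RHS](cobd0 _ (y' :: b)); apply: eq_cobd => t.
  by apply: xprod_head => s; apply: phi0.
(* In the [a] direction, only the face omitting the first vertex does not start at [q] again. *)
rewrite cobd_cons [X in _ - X](_ : _ = 0) ?subr0; last first.
  rewrite -[RHS](cobd0 _ (x' :: a)); apply: eq_cobd => t.
  by apply: xprod_head => s; apply: phi0.
rewrite (@eq_xprod _ _ _ (cup m (fun s => u (q :: s)) v)) //.
rewrite IHm //.
- congr (_ * _); apply: uR; rewrite /= Rxx /=.
  rewrite -[X in R _ X]addr0 Rb ?inE ?eqxx ?orbT //=.
  by elim: (a) => //= z s ->; rewrite Rxx.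
- by move=> s t st; apply: uR; rewrite /= Rxx.
by move=> s1 x1 y1 s2 le_s Rx1; rewrite -cat_cons u0.
Qed.

End CupXprod.

(** * Product cycles and their pairing with the label cocycles *)

Section Cycles.
Variable p : nat.
Hypothesis p_pr : prime p.
Local Notation F := 'F_p.
Variable G : zmodType.

Definition level := ((F -> G) * seq (G -> F))%type.
Implicit Types (L : seq level) (phi psi omega : seq G -> F).

(** Iterated cross product of the cycles [zcyc], carried along the maps [i] and starting from the
    vertex 0. The head level is the last factor, in agreement with the order in [labels]. *)
Fixpoint cyc L phi : F :=
  if L is (i, l) :: L' then
    zcyc (size l) (fun b => cyc L' (fun a => xprod phi a (map i b)))
  else phi [:: 0].

Fixpoint labels L : seq (G -> F) :=
  if L is (i, l) :: L' then labels L' ++ l else [::].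

Local Notation deg L := (size (labels L) * p.-1)%N.

Definition invariant (T : Type) (act : G -> T -> T) (omega : seq T -> F) :=
  forall g s, omega (map (act g) s) = omega s.

Lemma all_InP (T : Type) (a : pred T) (r : seq T) :
  reflect (forall x, List.In x r -> a x) (all a r).
Proof.
elim: r => [|x r IHr] /=; first by left.
apply: (iffP andP) => [[ax /IHr ar] y [<-|/ar]|ar] //.
by split; [apply: ar; left | apply/IHr => y y_r; apply: ar; right].
Qed.

Lemma eq_cup_labels (P : Type) (r : seq (P -> F)) s t :
  (forall chi, List.In chi r -> map chi s = map chi t) ->
  cup_labels r s = cup_labels r t.
Proof.
elim: r s t => [|chi r IHr] s t E //=; rewrite /cup -?map_take ?map_take.
rewrite (E chi) //=; last by left.
by congr (_ * _); apply: IHr => chi' r_chi'; rewrite !map_drop E //; right.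
Qed.

(** Consecutive Vandermonde blocks share a vertex, so two adjacent vertices always lie in a common
    block, where they give a repeated label. *)
Lemma cup_labels_repeat (P : Type) (r : seq (P -> F)) s1 x y s2 :
  (size (s1 ++ x :: y :: s2) <= (size r * p.-1).+1)%N ->
  (forall chi, List.In chi r -> chi x = chi y) ->
  cup_labels r (s1 ++ x :: y :: s2) = 0.
Proof.
elim: r s1 => [|chi r IHr] s1 /=; first by rewrite size_cat /= !addnS.
move=> le_s E; rewrite /cup; have [le_s1|lt_s1] := leqP p.-1 (size s1).
  rewrite -{2}(cat_take_drop p.-1 s1) -catA drop_size_cat ?size_takel //.
  rewrite IHr ?mulr0 // => [|chi' r_chi']; last by apply: E; right.
  by move: le_s; rewrite !size_cat size_drop mulSn /=; lia.
rewrite vdm_repeat ?mul0r // -[x :: y :: s2]/([:: x; y] ++ s2) catA take_cat ifN.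
  rewrite !map_cat !cat_uniq /= (E chi); last by left.
  by rewrite inE eqxx !andbF.
by rewrite -leqNgt size_cat /= addn2 ltnS.
Qed.

Lemma cup_labels_shift (r : seq (G -> F)) g s :
  (forall chi, List.In chi r -> {morph chi : x y / x + y}) ->
  cup_labels r [seq g + x | x <- s] = cup_labels r s.
Proof.
elim: r s => [|chi r IHr] s E //=; rewrite /cup -map_take -map_drop IHr; last first.
  by move=> chi' r_chi'; apply: E; right.
congr (_ * _); rewrite -[RHS](vdm_shift (chi g)) -!map_comp; congr vdm.
by apply: eq_map => x /=; apply: E; left.
Qed.

Lemma cup_labels_cancel (i : F -> G) (r : seq (G -> F)) s :
  (forall chi, List.In chi r -> cancel i chi) ->
  cup_labels r (map i s) = cup_labels (nseq (size r) id) s.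
Proof.
elim: r s => [|chi r IHr] s E //=; rewrite /cup -map_take -map_drop IHr; last first.
  by move=> chi' r_chi'; apply: E; right.
congr (vdm _ * _); rewrite -map_comp; apply: eq_map => x /=.
by apply: E; left.
Qed.

Lemma eq_zcyc M (eta eta' : seq F -> F) :
  (forall b, size b = (M * p.-1).+1 -> eta b = eta' b) -> zcyc M eta = zcyc M eta'.
Proof. by move=> E; apply: eq_lsum => b sz_b; rewrite E //= sz_b. Qed.

Lemma zcycZ M c (eta : seq F -> F) : zcyc M (fun b => c * eta b) = c * zcyc M eta.
Proof. by rewrite /zcyc -lsumZ; apply: eq_lsum => b _; rewrite mulrCA. Qed.

Lemma eq_cyc L phi psi : (forall s, size s = (deg L).+1 -> phi s = psi s) ->
  cyc L phi = cyc L psi.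
Proof.
elim: L phi psi => [|[i l] L IHL] phi psi E /=; first exact: E.
apply: eq_zcyc => b sz_b; apply: IHL => a sz_a; apply: eq_xprod => s.
rewrite size_map sz_a sz_b => sz_s; apply: E.
by rewrite sz_s /= size_cat mulnDl; lia.
Qed.

Lemma cycB L phi psi : cyc L (fun s => phi s - psi s) = cyc L phi - cyc L psi.
Proof.
elim: L phi psi => [|[i l] L IHL] phi psi //=.
rewrite /zcyc -lsumB; apply: eq_lsum => b _; rewrite -mulrBr -IHL.
by congr (_ * _); apply: eq_cyc => a _; apply: xprodB.
Qed.

Lemma cyc0 L : cyc L (fun=> 0) = 0.
Proof.
rewrite -[RHS](subrr (cyc L (fun=> 0))) -cycB.
by apply: eq_cyc => s _; rewrite subrr.
Qed.

Lemma cycD L phi psi : cyc L (fun s => phi s + psi s) = cyc L phi + cyc L psi.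
Proof.
transitivity (cyc L (fun s => phi s - (0 - psi s))).
  by apply: eq_cyc => s _; rewrite sub0r opprK.
by rewrite !cycB cyc0 sub0r opprK.
Qed.

Lemma cycZ L c phi : cyc L (fun s => c * phi s) = c * cyc L phi.
Proof.
elim: L phi => [|[i l] L IHL] phi //=; rewrite -zcycZ.
by apply: eq_zcyc => b _; rewrite -IHL; apply: eq_cyc => a _; apply: xprodZ.
Qed.

Lemma cyc_cobdr (T : Type) L (Phi : seq G -> seq T -> F) b :
  cyc L (fun a => ncobd (Phi a) b) = ncobd (fun b' => cyc L (Phi^~ b')) b.
Proof.
rewrite /ncobd; case: ifP => _; first exact: cyc0.
elim: b Phi => [|y b IHb] Phi /=; first exact: cyc0.
by rewrite cycB IHb.
Qed.

(** Triangularity: the labels of a level read off the coordinate along its own axis, and the labels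
    of the levels after it in the list vanish on that axis. *)
Fixpoint admissible L : Prop :=
  if L is (i, l) :: L' then
    [/\ {morph i : x y / x + y}, (0 < size l)%N,
        (forall chi, List.In chi l -> {morph chi : x y / x + y} /\ cancel i chi),
        (forall chi x, List.In chi (labels L') -> chi (i x) = 0) & admissible L']
  else True.

(** Of the two parts of the boundary of a cross product, one vanishes by induction and the other
    because [zcyc] is a cycle modulo translations. *)
Lemma cyc_cobd L omega : admissible L -> invariant +%R omega -> cyc L (ncobd omega) = 0.
Proof.
elim: L omega => [|[i l] L IHL] omega /=; first by rewrite /ncobd.
move=> [iD l_gt0 _ _ adL] om_inv.
transitivity (zcyc (size l) (fun b => (-1) ^+ deg L *
   cobd (fun b' => cyc L (fun a => xprod omega a (map i b'))) b)).
  apply: eq_zcyc => b sz_b.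
  have b_gt0 : (0 < size b)%N by rewrite sz_b.
  transitivity (cyc L (fun a => ncobd (fun a' => xprod omega a' (map i b)) a) +
      (-1) ^+ deg L * cyc L (fun a => ncobd (xprod omega a) (map i b))).
    rewrite -cycZ -cycD; apply: eq_cyc => a sz_a.
    by rewrite xprod_ncobd ?size_map ?sz_a.
  rewrite IHL ?add0r //; last first.
    move=> g [|x a] //; rewrite xprod_shiftl ?size_map //.
    by apply: eq_xprod => s _; apply: om_inv.
  rewrite cyc_cobdr /ncobd size_map leqNgt ifF; last first.
    by rewrite sz_b ltnS muln_gt0 l_gt0 /= -subn1 subn_gt0 prime_gt1.
  by rewrite cobd_map.
rewrite zcycZ zcyc_cobd ?mulr0 // => t b.
apply: eq_cyc => -[|x a] // _; case: b => [|y b] //.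
transitivity (xprod omega (x :: a) [seq i t + z | z <- map i (y :: b)]).
  by rewrite -map_comp -map_comp; congr xprod; apply: eq_map => z /=; rewrite iD.
by rewrite xprod_shiftr //; apply: eq_xprod => s _; apply: om_inv.
Qed.

Lemma labels_additive L chi : admissible L -> List.In chi (labels L) ->
  {morph chi : x y / x + y}.
Proof.
elim: L => [|[i l] L IHL] //= [_ _ l_ok _ adL] /List.in_app_iff[|/l_ok[]//].
exact: IHL.
Qed.

(** By triangularity [xprod_cup] splits off one level at a time, and a level with labels [l]
    contributes the nonzero factor [kappa p ^+ size l]. *)
Lemma cyc_cup_labels L : admissible L -> cyc L (cup_labels (labels L)) != 0.
Proof.
elim: L => [_|[i l] L IHL] /=; first by [].
move=> [iD l_gt0 l_ok L_i adL].
have additive0 (chi : G -> F) : {morph chi : x y / x + y} -> chi 0 = 0.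
  by move=> chiD; apply: (@addrI _ (chi 0)); rewrite -chiD !addr0.
pose R x y := all (fun chi : G -> F => chi x == chi y) (labels L).
have RP x y : reflect (forall chi, List.In chi (labels L) -> chi x = chi y) (R x y).
  by apply: (iffP (all_InP _ _)) => [H chi /H/eqP|H chi /H->].
suff -> : zcyc (size l) (fun b => cyc L (fun a =>
    xprod (cup_labels (labels L ++ l)) a (map i b))) =
    kappa p ^+ size l * cyc L (cup_labels (labels L)).
  by rewrite mulf_neq0 ?expf_neq0 ?kappa_neq0 ?IHL.
rewrite -zcyc_cup_labels // mulrC -zcycZ; apply: eq_zcyc => b sz_b.
rewrite mulrC -cycZ; apply: eq_cyc => a sz_a.
rewrite (@eq_xprod _ _ _ (cup (deg L) (cup_labels (labels L)) (cup_labels l))); last first.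
  by move=> s _; rewrite cup_labels_cat.
rewrite (xprod_cup (R := R)) ?size_map ?sz_b //.
- rewrite mulrC cup_labels_shift; last by move=> chi /l_ok[].
  by rewrite cup_labels_cancel // => chi /l_ok[].
- move=> s t st; apply: eq_cup_labels => chi chi_in.
  elim: s t st => [|x s IHs] [|y t] //=.
  move=> /andP[/RP Rxy /IHs->].
  by rewrite Rxy.
- move=> s1 x y s2 le_s /RP Rxy; exact: cup_labels_repeat.
- by move=> x; apply/RP.
move=> x y y' y_b y'_b; apply/RP => chi chi_in.
have chiD := labels_additive adL chi_in.
have chi_b z : z \in 0 :: map i b -> chi z = 0.
  rewrite inE => /orP[/eqP->|/mapP[t _ ->]]; last exact: L_i.
  exact: additive0.
by rewrite !chiD (chi_b y) // (chi_b y').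
Qed.

Theorem cup_labels_not_cobd L omega : admissible L -> (0 < deg L)%N -> invariant +%R omega ->
  ~ (forall s, size s = (deg L).+1 -> cup_labels (labels L) s = cobd omega s).
Proof.
move=> adL L_gt0 om_inv E; have /eqP := cyc_cup_labels adL; apply.
rewrite -(cyc_cobd adL om_inv); apply: eq_cyc => s sz_s.
by rewrite E // /ncobd leqNgt sz_s ltnS L_gt0.
Qed.

End Cycles.

(** * Characters of elementary abelian groups *)

Section Characters.
Variables (p alpha d : nat).
Hypothesis p_pr : prime p.
Hypothesis d_gt0 : (0 < d)%N.
Local Notation F := 'F_p.
Local Notation G := {ffun 'I_alpha -> F}.
Implicit Types (c g h x : G) (n : nat).

Definition chi c x : F := \sum_i c i * x i.
Definition axis n (t : F) : G := [ffun i => if val i == n then t else 0].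

(* One normalised character for each hyperplane: the last nonzero coordinate is
   the [n]-th one, and it is [1]. *)
Definition normalized n : {set G} :=
  [set c : G | [forall i, (n <= val i)%N ==> (c i == (val i == n)%:R)]].

Lemma normalizedP n c :
  reflect (forall i, (n <= val i)%N -> c i = (val i == n)%:R) (c \in normalized n).
Proof.
rewrite inE; apply: (iffP forallP) => H i; last by apply/implyP => /H->.
by move=> le_ni; apply/eqP; have /implyP := H i; apply.
Qed.

Lemma chiD c : {morph chi c : x y / x + y}.
Proof.
by move=> x y; rewrite -big_split; apply: eq_bigr => i _; rewrite !ffunE mulrDr.
Qed.

Lemma chiDl c c' x : chi (c + c') x = chi c x + chi c' x.
Proof. by rewrite -big_split; apply: eq_bigr => i _; rewrite !ffunE mulrDl. Qed.

Lemma chi_axis c (i : 'I_alpha) t : chi c (axis i t) = c i * t.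
Proof.
rewrite /chi (bigD1 i) //= big1 ?addr0 ?ffunE ?eqxx // => j neq_ji.
by rewrite ffunE ifN ?mulr0.
Qed.

Lemma chi_axisl (i : 'I_alpha) t x : chi (axis i t) x = t * x i.
Proof.
by rewrite -(mulrC (x i)) -chi_axis; apply: eq_bigr => j _; rewrite mulrC.
Qed.

Lemma axisD n : {morph axis n : s t / s + t}.
Proof.
by move=> s t; apply/ffunP => i; rewrite !ffunE; case: ifP; rewrite ?addr0.
Qed.

Lemma card_normalized n : (n <= alpha)%N -> (#|normalized n| <= p ^ n)%N.
Proof.
move=> le_n; have <- : #|{: {ffun 'I_n -> F}}| = (p ^ n)%N.
  by rewrite card_ffun card_Fp // card_ord.
pose r c : {ffun 'I_n -> F} := [ffun i => c (widen_ord le_n i)].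
rewrite -cardsT -(card_in_imset (f := r) (D := normalized n)).
  by apply: subset_leq_card; apply: finset.subsetT.
move=> c c' /normalizedP c_n /normalizedP c'_n /ffunP E; apply/ffunP => i.
have [le_ni|lt_in] := leqP n i; first by rewrite c_n // c'_n.
have := E (Ordinal lt_in); rewrite !ffunE.
by have -> : widen_ord le_n (Ordinal lt_in) = i by apply: val_inj.
Qed.

Definition level_index n : seq (G * 'I_d) :=
  [seq (c, j) | c <- enum (normalized n), j <- enum 'I_d].

Fixpoint char_index n : seq (G * 'I_d) :=
  if n is n'.+1 then char_index n' ++ level_index n' else [::].

Fixpoint char_levels n : seq (level p G) :=
  if n is n'.+1 then
    (axis n', [seq chi cj.1 | cj <- level_index n']) :: char_levels n'
  else [::].

Lemma labels_char_levels n :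
  labels (char_levels n) = [seq chi cj.1 | cj <- char_index n].
Proof. by elim: n => //= n ->; rewrite map_cat. Qed.

Lemma mem_level_index n c j : ((c, j) \in level_index n) = (c \in normalized n).
Proof.
apply/allpairsPdep/idP => [[c' [j' [c'_in _ [-> _]]]]|c_in].
  by rewrite mem_enum in c'_in.
by exists c, j; rewrite !mem_enum.
Qed.

Lemma mem_char_index n c j :
  ((c, j) \in char_index n) = [exists i : 'I_n, c \in normalized i].
Proof.
elim: n => [|n IHn] /=; first by symmetry; apply/existsP => -[[]].
rewrite mem_cat IHn mem_level_index; apply/orP/existsP => [[/existsP[i c_i]|c_n]|[i c_i]].
- by exists (widen_ord (leqnSn n) i).
- by exists ord_max.
have [lt_in|le_ni] := ltnP i n; first by left; apply/existsP; exists (Ordinal lt_in).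
by right; rewrite (_ : n = i) //; apply/eqP; rewrite eqn_leq le_ni -ltnS ltn_ord.
Qed.

Lemma axis_normalized (i : 'I_alpha) : axis i 1 \in normalized i.
Proof. by apply/normalizedP => j _; rewrite ffunE; case: ifP. Qed.

(** Level i contributes at most d p^i pairs, and the numbers p^i (p - 1) for i < n add up to p^n -
    1. *)
Lemma size_char_index n : (n <= alpha)%N ->
  (size (char_index n) * p.-1 <= d * (p ^ n - 1))%N.
Proof.
elim: n => [|n IHn] lt_n //=.
rewrite size_cat mulnDl size_allpairs -cardE size_enum_ord.
have P_gt0 : (0 < p ^ n)%N by rewrite expn_gt0 prime_gt0.
have -> : (d * (p ^ n.+1 - 1) = d * (p ^ n - 1) + p ^ n * d * p.-1)%N.
  move: P_gt0 (prime_gt0 p_pr); rewrite expnS; move: (p ^ n)%N => [|P] // _.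
  by case: p => [|q] // _; rewrite !subn1 /=; nia.
rewrite leq_add ?IHn ?leq_mul ?(ltnW lt_n) //.
exact: card_normalized (ltnW lt_n).
Qed.

Lemma In_map_mem (T : eqType) (U : Type) (f : T -> U) (r : seq T) y :
  List.In y (map f r) -> exists2 x, x \in r & y = f x.
Proof.
elim: r => //= x r IHr [<-|/IHr[z z_r ->]]; first by exists x; rewrite ?mem_head.
by exists z; rewrite ?inE ?z_r ?orbT.
Qed.

Lemma mem_In_map (T : eqType) (U : Type) (f : T -> U) (r : seq T) (x : T) :
  x \in r -> List.In (f x) (map f r).
Proof.
by elim: r => //= y r IHr; rewrite inE => /orP[/eqP->|/IHr]; [left | right].
Qed.

Lemma char_levels_admissible n : (n <= alpha)%N -> admissible (char_levels n).
Proof.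
elim: n => [|n IHn] lt_n //=; pose i := Ordinal lt_n.
split; last exact/IHn/ltnW.
- exact: axisD.
- rewrite size_map -has_predT; apply/hasP; exists (axis n 1, Ordinal d_gt0) => //.
  by rewrite mem_level_index; apply: (axis_normalized i).
- move=> c c_in; have [[c' j]] := In_map_mem c_in; rewrite mem_level_index => /normalizedP c'_n -> /=.
  split=> [|t]; first exact: chiD.
  by rewrite (chi_axis _ i) c'_n //= eqxx mul1r.
move=> c t; rewrite labels_char_levels => c_in; have [[c' j]] := In_map_mem c_in.
rewrite mem_char_index => /existsP[i' /normalizedP c'_i'] -> /=.
rewrite (chi_axis _ i) c'_i' /= ?(ltnW (ltn_ord i')) //.
by rewrite gtn_eqF ?mul0r.
Qed.

Lemma size_char_index_gt0 : (0 < alpha)%N -> (0 < size (char_index alpha))%N.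
Proof.
move=> alpha_gt0; rewrite -has_predT; apply/hasP.
exists (axis 0 1, Ordinal d_gt0) => //; rewrite mem_char_index.
by apply/existsP; exists (Ordinal alpha_gt0); apply: (axis_normalized (Ordinal alpha_gt0)).
Qed.

Definition annihilator x : {set G} := [set c : G | chi c x == 0].

(** * Inversion of hyperplane sums *)

Section HyperplaneSums.
Variables (R : numFieldType) (y : G -> R).

Definition fiber_sum c (a : F) : R := \sum_(h | chi c h == a) y h.

Hypothesis fiber_sum_const : forall n c a b, (n < alpha)%N -> c \in normalized n ->
  fiber_sum c a = fiber_sum c b.

Lemma fiber_sum_neq0 c a b : c != 0 -> fiber_sum c a = fiber_sum c b.
Proof.
move=> c_neq0; have [i0 ci0] : exists i, c i != 0.
  apply/existsP; apply: contraNT c_neq0; rewrite negb_exists => /forallP c0.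
  by apply/eqP/ffunP => i; rewrite ffunE; apply/eqP; rewrite -[_ == _]negbK c0.
(* Dividing [c] by its last nonzero coordinate normalises it and only rescales the values of the
   character. *)
pose i := [arg max_(j > i0 | c j != 0) (val j)].
have [ci i_max] : c i != 0 /\ (forall j, c j != 0 -> (j <= i)%N).
  by rewrite /i; case: arg_maxnP.
pose c' : G := [ffun j => (c i)^-1 * c j].
have c'_n : c' \in normalized i.
  apply/normalizedP => j le_ij; rewrite ffunE.
  have [/val_inj->|neq_ji] := eqVneq (val j) (val i); first by rewrite mulVf.
  have [->|/i_max le_ji] := eqVneq (c j) 0; first by rewrite mulr0.
  by case/eqP: neq_ji; apply/eqP; rewrite eqn_leq le_ji.
have E t : fiber_sum c t = fiber_sum c' ((c i)^-1 * t).
  apply: eq_bigl => h; rewrite (_ : chi c' h = (c i)^-1 * chi c h).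
    by rewrite (inj_eq (mulfI _)) ?invr_neq0.
  by rewrite big_distrr /=; apply: eq_bigr => j _; rewrite ffunE mulrA.
by rewrite !E; apply: fiber_sum_const (ltn_ord i) c'_n.
Qed.

(** For each [a] in the field, the characters with value [a] at [x] form a translate of the
    annihilator. *)
Lemma card_annihilator x : x != 0 -> (#|annihilator x| * p)%N = #|{: G}|.
Proof.
move=> x_neq0; have [i xi] : exists i, x i != 0.
  apply/existsP; apply: contraNT x_neq0; rewrite negb_exists => /forallP x0.
  by apply/eqP/ffunP => i; rewrite ffunE; apply/eqP; rewrite -[_ == _]negbK x0.
rewrite -[RHS]sum1_card (partition_big (chi^~ x) predT) //=.
rewrite (eq_bigr (fun=> #|annihilator x|)) => [|a _].
  by rewrite sum_nat_const card_Fp // mulnC.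
rewrite sum1_card -(card_imset (annihilator x) (addrI (axis i (a / x i)))).
apply: eq_card => c; rewrite -[LHS]/(chi c x == a); apply/eqP/imsetP => [ca|[c' + ->]].
  exists (c - axis i (a / x i)); last by rewrite addrCA subrr addr0.
  have := chiDl (c - axis i (a / x i)) (axis i (a / x i)) x.
  rewrite subrK ca chi_axisl mulfVK // => E.
  by rewrite inE; apply/eqP/(addIr a); rewrite -E add0r.
by rewrite inE chiDl chi_axisl mulfVK // => /eqP->; rewrite addr0.
Qed.

(** Summing over all characters the fiber through [g] counts [y h] once for each character vanishing
    at h - g: |G| times if h = g, and |G| / p times otherwise. As this sum does not depend on [g],
    neither does [y g]. *)
Lemma fiber_sums_const_eq g h : y g = y h.
Proof.
pose K x : R := #|annihilator x|%:R.
have sumK g' : \sum_c fiber_sum c (chi c g') = \sum_h' y h' * K (h' - g').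
  rewrite /fiber_sum (exchange_big_dep predT) //=; apply: eq_bigr => h' _.
  rewrite sumr_const -mulr_natr; congr (_ * _%:R); apply: eq_card => c.
  rewrite [RHS]inE -[LHS]/(chi c h' == chi c g').
  have -> : chi c h' = chi c (h' - g') + chi c g' by rewrite -chiD subrK.
  by apply/eqP/eqP => [E|->]; [apply: (addIr (chi c g'))|]; rewrite add0r.
have K0 : K 0 = #|{: G}|%:R.
  congr _%:R; rewrite -cardsT; apply: eq_card => c; rewrite !inE.
  by rewrite /chi big1 ?eqxx // => i _; rewrite ffunE mulr0.
have KN x : x != 0 -> K x = #|{: G}|%:R / p%:R.
  move=> /card_annihilator <-; rewrite natrM mulfK // pnatr_eq0 -lt0n.
  exact: prime_gt0.
have sumE g' : \sum_c fiber_sum c (chi c g') =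
   (\sum_h' y h') * (#|{: G}|%:R / p%:R) + y g' * (#|{: G}|%:R * (1 - p%:R^-1)).
  rewrite sumK (bigD1 g') //= subrr K0.
  rewrite (eq_bigr (fun h' => y h' * (#|{: G}|%:R / p%:R))); last first.
    by move=> h' neq; rewrite KN // subr_eq0.
  rewrite [in RHS](bigD1 g') //= -big_distrl /=; ring.
have : \sum_c fiber_sum c (chi c g) = \sum_c fiber_sum c (chi c h).
  apply: eq_bigr => c _; have [->|/fiber_sum_neq0//] := eqVneq c 0.
  by apply: eq_bigl => h'; rewrite /chi !big1 // => i _; rewrite ffunE mul0r.
rewrite !sumE => /addrI /mulIf; apply.
rewrite mulf_neq0 //; first by rewrite pnatr_eq0 -lt0n; apply/card_gt0P; exists 0.
by rewrite subr_eq0 eq_sym invr_eq1 pnatr_eq1 gtn_eqF ?prime_gt1.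
Qed.

End HyperplaneSums.

End Characters.

(** * Matrices in general position *)

Section MatrixNorm.
Variable R : realType.

Lemma le_mx_norm m n (x : 'M[R]_(m, n)) i j : `|x i j| <= `|x|.
Proof.
rewrite -[leRHS]/(mx_norm x) mx_normrE.
by apply/bigmax_geP; right; exists (i, j).
Qed.

Lemma mx_norm_le m n (x : 'M[R]_(m, n)) b : 0 <= b ->
  (forall i j, `|x i j| <= b) -> `|x| <= b.
Proof.
move=> b_ge0 le_xb; rewrite -[leLHS]/(mx_norm x) mx_normrE.
by apply/bigmax_leP; split=> // -[i j] _; apply: le_xb.
Qed.

Lemma mx_norm_mul m n k (A : 'M[R]_(m, n)) (B : 'M[R]_(n, k)) :
  `|A *m B| <= n%:R * `|A| * `|B|.
Proof.
apply: mx_norm_le => [|i j]; first by rewrite !mulr_ge0 ?ler0n.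
rewrite mxE (le_trans (ler_norm_sum _ _ _)) // -mulrA mulr_natl.
rewrite -[X in _ *+ X]card_ord -sumr_const ler_sum // => l _.
by rewrite normrM ler_pM ?le_mx_norm.
Qed.

Lemma mx_norm_attained m (w : 'cV[R]_m) : w != 0 -> exists q, `|w| = `|w q 0|.
Proof.
rewrite -normr_eq0 => w0; have [[q j] /= E] := mx_norm_neq0 w0.
by exists q; rewrite -[LHS]/(mx_norm w) E (ord1 j).
Qed.

End MatrixNorm.

Section Avoid.
Variables (R : realType) (n k' m : nat) (K : finType).
Local Notation k := k'.+1.
Variables (C : K -> 'I_m -> 'M[R]_(n, k)) (S : nat).
Hypothesis le_dim : (k' + m < n)%N.

Let pert (A : 'M[R]_(n, k)) kap (s : 'I_m -> R) := A + \sum_l s l *: C kap l.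

(* The bad matrices form the image of a space of dimension [n k - 1] under a
   Lipschitz map, so they cannot come close to all points of a fine grid: two
   distinct grid points would be bad for nearly the same parameters. *)
Lemma avoid_normalized : exists (A : 'M[R]_(n, k)) (eta : R),
  [/\ `|A| <= 1, 0 < eta & forall kap (s : 'I_m -> R) (w : 'cV[R]_k) q,
    (forall l, 0 <= s l <= S%:R) -> `|w| <= 1 -> w q 0 = 1 ->
    eta <= `|pert A kap s *m w|].
Proof.
pose c : R := \sum_kap \sum_l `|C kap l|.
have le_c kap l : `|C kap l| <= c.
  rewrite /c (bigD1 kap) //= (bigD1 l) //= -addrA lerDl.
  by rewrite addr_ge0 ?sumr_ge0 // => *; rewrite ?sumr_ge0.
pose b : R := k%:R + m%:R * k%:R * (c * (1 + S%:R)).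
have b_ge0 : 0 <= b.
  have c_ge0 : 0 <= c by rewrite sumr_ge0 // => *; rewrite sumr_ge0.
  by rewrite /b addr_ge0 ?mulr_ge0 ?addr_ge0 ?ler0n.
(* [L] absorbs the Lipschitz constant [b]. The grid has [M] values per entry, and [M] exceeds the
   factor [D] in the number D M^(n k' + k' + m) of keys below. *)
pose L := (Num.truncn (4 * b)).+1; pose S' := S.+2.
pose D := (#|K| * k * (S'.+1 * L) ^ (k' + m))%N; pose M := D.+1.
pose W := (S'.+1 * L * M)%N.
have M_gt0 : (0 : R) < M%:R by rewrite ltr0n.
have L_gt0 : (0 : R) < L%:R by rewrite ltr0n.
have lt_bL : 4 * b < L%:R by rewrite truncnS_gt.
pose eta : R := (8 * M%:R)^-1.
have eta_gt0 : 0 < eta by rewrite invr_gt0 mulr_gt0 ?ltr0n.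
pose grid (a : {ffun 'I_n * 'I_k -> 'I_M}) : 'M[R]_(n, k) :=
  \matrix_(i, j) ((a (i, j))%:R / M%:R).
apply: contrapT => no_A.
have bad a : exists x : K * ('I_m -> R) * 'cV[R]_k * 'I_k,
    let: (kap, s, w, q) := x in
    [/\ (forall l, 0 <= s l <= S%:R), `|w| <= 1, w q 0 = 1 &
      `|pert (grid a) kap s *m w| < eta].
  apply: contrapT => no_x; apply: no_A; exists (grid a), eta; split=> //.
    apply: mx_norm_le => // i j; rewrite mxE ger0_norm ?divr_ge0 ?ler0n //.
    by rewrite ler_pdivrMr // mul1r ler_nat ltnW.
  move=> kap s w q s_le w_le wq; rewrite leNgt; apply/negP => lt_eta.
  by apply: no_x; exists (kap, s, w, q).
have [x x_bad] := choice bad.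
pose cell (z : R) : 'I_W.-1.+1 := inord (Num.truncn (z * L%:R * M%:R)).
(* Column [q] of [a] is left out: since [w q 0 = 1], the other data determine it up to an error
   below 1 / M. The shift by 1 makes the coordinates of [w] nonnegative. *)
pose key a := let: (kap, s, w, q) := x a in
  (kap, q, [ffun ij : 'I_n * 'I_k' => a (ij.1, lift q ij.2)],
   [ffun j : 'I_k' => cell (w (lift q j) 0 + 1)], [ffun l : 'I_m => cell (s l)]).
have W_gt0 : (0 < W)%N by rewrite !muln_gt0.
have cellP z z' : 0 <= z <= S'%:R -> 0 <= z' <= S'%:R -> cell z = cell z' ->
    `|z - z'| <= (L%:R * M%:R)^-1.
  have trunc_lt y : 0 <= y <= S'%:R -> (Num.truncn (y * L%:R * M%:R) < W)%N.
    move=> /andP[y_ge0 y_le]; rewrite truncn_lt_nat ?mulr_ge0 // /W !natrM.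
    by rewrite !ltr_pM2r // (le_lt_trans y_le) // ltr_nat.
  move=> z_S z'_S /(congr1 (@nat_of_ord _)); rewrite /cell !inordK ?prednK ?trunc_lt //.
  case/andP: z_S z'_S => z_ge0 _ /andP[z'_ge0 _] E.
  have /andP[z1 z2] := truncn_itv (mulr_ge0 (mulr_ge0 z_ge0 (ltW L_gt0)) (ltW M_gt0)).
  have /andP[z'1 z'2] := truncn_itv (mulr_ge0 (mulr_ge0 z'_ge0 (ltW L_gt0)) (ltW M_gt0)).
  have LM_gt0 : 0 < L%:R * M%:R :> R by rewrite mulr_gt0.
  rewrite -[leRHS]mul1r ler_pdivlMr // -[X in _ * X]gtr0_norm // -normrM.
  rewrite mulrBl !mulrA ler_norml; rewrite {}E in z1 z2.
  move: z1 z2 z'1 z'2; rewrite -addn1 natrD; move: (_%:R) => u; lra.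
have key_inj : injective key.
  move=> a a'; rewrite /key; have := x_bad a; have := x_bad a'.
  case: (x a') => -[[kap' s'] w'] q' [s'_le w'_le w'q' bad'].
  case: (x a) => -[[kap s] w] q [s_le w_le wq bad_a].
  case=> Ekap Eq /ffunP Ea /ffunP Ew /ffunP Es.
  move: Ekap Eq bad' w'q' Ea Ew => <- <- {kap' q'} bad' w'q Ea Ew.
  pose delta : R := (L%:R * M%:R)^-1.
  have delta_ge0 : 0 <= delta by rewrite invr_ge0 mulr_ge0.
  have s_close l : `|s l - s' l| <= delta.
    have SS' : S%:R <= S'%:R :> R by rewrite ler_nat /S' -addn2 leq_addr.
    apply: cellP; last by have := Es l; rewrite !ffunE.
      by have /andP[-> /le_trans->] := s_le l.
    by have /andP[-> /le_trans->] := s'_le l.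
  have w_close : `|w - w'| <= delta.
    apply: mx_norm_le => // i j; rewrite (ord1 j) !mxE.
    case: (unliftP q i) => [i' ->|->]; last by rewrite wq w'q subrr normr0.
    have in_S' (v : 'cV[R]_k) : `|v| <= 1 -> 0 <= v (lift q i') 0 + 1 <= S'%:R.
      move=> v_le; have := le_trans (le_mx_norm v (lift q i') 0) v_le.
      have : 2 <= S'%:R :> R by rewrite ler_nat.
      by rewrite ler_norml; move: (S'%:R) => u; lra.
    have := cellP _ _ (in_S' _ w_le) (in_S' _ w'_le).
    have := Ew i'; rewrite !ffunE => -> /(_ erefl).
    by rewrite opprD addrACA subrr addr0.
  set A := grid a in bad_a; set A' := grid a' in bad'.
  have A_le : `|A| <= 1.
    apply: mx_norm_le => // i j; rewrite mxE ger0_norm ?divr_ge0 ?ler0n //.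
    by rewrite ler_pdivrMr // mul1r ler_nat ltnW.
  have diffE : pert A kap s *m w - pert A' kap s' *m w' =
      (A - A') *m w' + (A *m (w - w') +
        \sum_l C kap l *m (s l *: w - s' l *: w')).
    rewrite /pert !mulmxDl !mulmx_suml mulmxBr mulNmx.
    under [in RHS]eq_bigr do rewrite mulmxBr -!scalemxAr.
    under [X in _ *m w + X]eq_bigr do rewrite -scalemxAl.
    under [X in A' *m w' + X]eq_bigr do rewrite -scalemxAl.
    rewrite sumrB; move: (A *m w) (A *m w') (A' *m w') (\sum_i _) (\sum_i _) => v1 v2 v3 v4 v5.
    by apply/matrixP => i j; rewrite !mxE; ring.
  have small : `|(A - A') *m w'| < M%:R^-1.
    have -> : (A - A') *m w' = pert A kap s *m w - pert A' kap s' *m w' -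
        (A *m (w - w') + \sum_l C kap l *m (s l *: w - s' l *: w')).
      by rewrite diffE addrK.
    have Aw : `|A *m (w - w')| <= k%:R * delta.
      rewrite (le_trans (mx_norm_mul _ _)) // -mulrA ler_wpM2l ?ler0n //.
      by rewrite -[leRHS]mul1r ler_pM.
    have Cw : `|\sum_l C kap l *m (s l *: w - s' l *: w')| <=
        m%:R * k%:R * (c * (1 + S%:R)) * delta.
      rewrite (le_trans (ler_norm_sum _ _ _)) // -!mulrA mulr_natl.
      rewrite -[X in _ *+ X]card_ord -sumr_const ler_sum // => l _.
      rewrite (le_trans (mx_norm_mul _ _)) // -mulrA ler_wpM2l ?ler0n // ler_pM //.
      have -> : s l *: w - s' l *: w' = (s l - s' l) *: w + s' l *: (w - w').
        by rewrite scalerBl scalerBr addrA subrK.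
      rewrite (le_trans (ler_normD _ _)) // !normrZ mulrDl lerD //.
        by rewrite mul1r -[leRHS]mulr1 ler_pM.
      have /andP[s'_ge0 s'_leS] := s'_le l.
      by rewrite ler_pM // ger0_norm.
    rewrite (le_lt_trans (ler_normB _ _)) //.
    have : `|pert A kap s *m w - pert A' kap s' *m w'| < eta + eta.
      by rewrite (le_lt_trans (ler_normB _ _)) // ltrD.
    have : `|A *m (w - w') + \sum_l C kap l *m (s l *: w - s' l *: w')| <= b * delta.
      by rewrite (le_trans (ler_normD _ _)) // mulrDl lerD.
    have : b * delta <= (4 * M%:R)^-1.
      rewrite /delta !invfM mulrA ler_pM2r ?invr_gt0 //.
      by rewrite ler_pdivrMr // mulrC ler_pdivlMr // mulrC ltW.
    have -> : M%:R^-1 = (4 * M%:R)^-1 + eta *+ 6 :> R.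
      by rewrite /eta; field; rewrite gt_eqF.
    by move: eta_gt0; rewrite -mulr_natr; lra.
  apply/ffunP => -[i j]; case: (unliftP q j) => [j' ->|->].
    by have := Ea (i, j'); rewrite !ffunE.
  have := le_lt_trans (le_mx_norm _ i 0) small.
  rewrite mxE (bigD1 q) //= w'q mulr1 big1 ?addr0 => [|j']; last first.
    case: (unliftP q j') => [j'' -> _|-> /eqP//].
    by rewrite !mxE; have := Ea (i, j''); rewrite !ffunE /= => ->; rewrite subrr mul0r.
  rewrite !mxE -mulrBl normrM normfV [`|M%:R|]gtr0_norm // ltr_pdivrMr // mulVf ?gt_eqF //.
  rewrite ltr_distl => /andP[lt1 lt2]; apply: val_inj; apply/eqP.
  by rewrite eqn_leq -ltnS -[X in _ && X]ltnS -!(ltr_nat R) -!natr1 lt2 -ltrBlDr.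
have := leq_card key key_inj.
rewrite !card_prod !card_ffun !card_prod !card_ord prednK //.
apply/negP; rewrite -ltnNge.
have -> : (#|K| * k * M ^ (n * k') * W ^ k' * W ^ m = D * M ^ (n * k' + (k' + m)))%N.
  by rewrite /D /W !expnD !expnMn; ring.
apply: (@leq_trans (M * M ^ (n * k' + (k' + m)))).
  by rewrite ltn_pmul2r ?expn_gt0.
by rewrite -expnS leq_pexp2l // mulnS -addnS addnC leq_add2r.
Qed.

End Avoid.

(** The claim is homogeneous in [w], so a coordinate of largest absolute value can be scaled to
    1. *)
Lemma avoid (R : realType) n k m (K : finType) (C : K -> 'I_m -> 'M[R]_(n, k)) (S : nat) :
  (k + m <= n)%N ->
  exists (A : 'M[R]_(n, k)) (eta : R), [/\ `|A| <= 1, 0 < eta &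
    forall kap (s : 'I_m -> R) (w : 'cV[R]_k), (forall l, 0 <= s l <= S%:R) ->
    eta * `|w| <= `|(A + \sum_l s l *: C kap l) *m w|].
Proof.
case: k C => [|k'] C le_dim.
  exists 0, 1; split; rewrite ?normr0 ?ler01 // => kap s w _.
  by rewrite (flatmx0 w) normr0 mulr0.
have [A [eta [A_le eta_gt0 A_ok]]] := avoid_normalized C S le_dim.
exists A, eta; split=> // kap s w s_le.
have [->|w_neq0] := eqVneq w 0; first by rewrite normr0 mulr0.
have [q Eq] := mx_norm_attained w_neq0.
have wq : w q 0 != 0 by rewrite -normr_eq0 -Eq normr_eq0.
have := A_ok kap s ((w q 0)^-1 *: w) q s_le.
rewrite normrZ normfV -Eq mulVf ?normr_eq0 // mxE mulVf // => /(_ (lexx _) erefl).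
rewrite -scalemxAr normrZ normfV -Eq => le_eta.
by rewrite -ler_pdivlMr ?normr_gt0 // mulrC.
Qed.

Section General.
Variables (R : realType) (n k : nat) (G : finZmodType) (rho : G -> 'M[R]_k).
Hypothesis rho0 : rho 0 = 1%:M.
Hypothesis rhoD : forall g h, rho (g + h) = rho g *m rho h.
Hypothesis rho_le : forall g, `|rho g| <= 1.

(** Induction on the number of matrices. If the last weight is small, the earlier matrices dominate.
    Otherwise dividing by it leaves bounded parameters, and the last matrix was chosen by [avoid]
    against all such combinations of translates of the earlier ones. *)
Lemma general_position m : (k + m <= n.+1)%N ->
  exists (A : nat -> 'M[R]_(n, k)) (c : R), [/\ forall l, `|A l| <= 1, 0 < c &
    forall (g : nat -> G) (t : nat -> R) (w : 'cV[R]_k), (forall l, 0 <= t l) ->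
    c * (\sum_(l < m) t l) * `|w| <=
    `|(\sum_(l < m) t l *: (A l *m rho (g l))) *m w|].
Proof.
elim: m => [|m IHm] le_dim.
  exists (fun=> 0), 1; split=> [l||g t w _]; rewrite ?normr0 ?ler01 //.
  by rewrite big_ord0 mulr0 mul0r.
have [|A [c [A_le c_gt0 A_ok]]] := IHm; first by rewrite ltnW // -addnS.
pose C (kap : {ffun 'I_m -> G}) (l : 'I_m) := A l *m rho (kap l).
(* This bounds the ratio of the earlier weights to the last one in the second case, where c T < 2 k
   (t m). *)
pose S := (Num.truncn (2 * k%:R / c)).+1.
have [|B [eta [B_le eta_gt0 B_ok]]] := @avoid R n k m _ C S; first by rewrite -ltnS -addnS.
have [k_eq0|k_gt0] := posnP k.
  exists A, 1; split=> // g t w _.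
  suff -> : `|w| = 0 by rewrite mulr0.
  apply/eqP; rewrite normr_eq0; apply/eqP/matrixP => i.
  by have lt_ik : (i < k)%N := ltn_ord i; lia.
have k_ge1 : 1 <= k%:R :> R by rewrite ler1n.
pose c' := Num.min (c / (k%:R * (2 + c))) (eta / (k%:R * (S%:R + 1))).
exists (fun l => if l == m then B else A l), c'; split.
- by move=> l; case: ifP.
- by rewrite lt_min !divr_gt0 ?mulr_gt0 ?addr_gt0 ?ltr0n.
move=> g t w t_ge0; rewrite !big_ord_recr /= eqxx.
rewrite (eq_bigr (fun l : 'I_m => t l *: (A l *m rho (g l)))) => [|l _]; last first.
  by rewrite ltn_eqF.
(* Passing from [w] to [u] removes the twist from the new matrix, so only the differences
   [g l - g m] matter and finitely many families [C] suffice. *)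
set T := \sum_(l < m) t l; set u := rho (g m) *m w.
have w_le : `|w| <= k%:R * `|u|.
  have -> : w = rho (- g m) *m u by rewrite mulmxA -rhoD addNr rho0 mul1mx.
  by rewrite (le_trans (mx_norm_mul _ _)) // ler_wpM2r // ler_piMr ?ler0n.
pose h l := g l - g m.
have -> : (\sum_(l < m) t l *: (A l *m rho (g l)) + t m *: (B *m rho (g m))) *m w =
    (\sum_(l < m) t l *: (A l *m rho (h l))) *m u + t m *: (B *m u).
  rewrite mulmxDl -scalemxAl -mulmxA; congr (_ + _); rewrite !mulmx_suml.
  apply: eq_bigr => l _; rewrite -!scalemxAl; congr (_ *: _).
  by rewrite -!mulmxA; congr (_ *m _); rewrite /u mulmxA -rhoD /h subrK.
have T_ge0 : 0 <= T by rewrite sumr_ge0.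
have := A_ok h t u t_ge0; rewrite -/T; set Y := _ *m u => Y_ge.
have tm_ge0 := t_ge0 m; have u_ge0 := normr_ge0 u.
have c'_ge0 : 0 <= c' by rewrite le_min !divr_ge0 ?mulr_ge0 ?addr_ge0 ?ler0n ?ltW.
apply: (@le_trans _ _ (c' * k%:R * (T + t m) * `|u|)).
  rewrite -!mulrA ler_wpM2l // mulrCA ler_wpM2l ?addr_ge0 //.
have [le_t|lt_t] := lerP (t m * (2 * k%:R)) (c * T).
  have Bu_le : `|t m *: (B *m u)| <= t m * k%:R * `|u|.
    rewrite normrZ (ger0_norm tm_ge0) -mulrA ler_wpM2l //.
    by rewrite (le_trans (mx_norm_mul _ _)) // ler_wpM2r // ler_piMr ?ler0n.
  have Z_ge : c * T * `|u| - t m * k%:R * `|u| <= `|Y + t m *: (B *m u)|.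
    by rewrite (le_trans _ (lerB_normD _ _)) // lerB.
  apply: le_trans Z_ge; rewrite -mulrBl ler_wpM2r //.
  have : c' * k%:R <= c / (2 + c).
    rewrite -ler_pdivlMr ?ltr0n // -mulrA -invfM mulrC (mulrC _ k%:R).
    by rewrite /c' ge_min mulrC lexx.
  rewrite ler_pdivlMr ?addr_gt0 // => c'_le.
  suff : c' * k%:R * (T + t m) * (2 + c) <= (c * T - t m * k%:R) * (2 + c).
    by rewrite ler_pM2r ?addr_gt0.
  apply: (@le_trans _ _ (c * (T + t m))).
    by rewrite mulrAC ler_wpM2r ?addr_ge0.
  have tk_ge : t m <= t m * k%:R by rewrite ler_peMr.
  have c_tk : c * t m <= c * (t m * k%:R) by rewrite ler_wpM2l // ltW.
  have c_cT : c * (t m * (2 * k%:R)) <= c * (c * T) by rewrite ler_wpM2l // ltW.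
  rewrite mulrDr mulrBl !mulrDr; lra.
have t_gt0 : 0 < t m.
  rewrite lt_neqAle tm_ge0 andbT; apply: contraTneq lt_t => <-.
  by rewrite mul0r -leNgt mulr_ge0 // ltW.
have -> : Y + t m *: (B *m u) =
    t m *: ((B + \sum_(l < m) (t l / t m) *: C [ffun l : 'I_m => h l] l) *m u).
  rewrite mulmxDl scalerDr addrC; congr (_ + _).
  rewrite scalemxAl scaler_sumr; congr (_ *m u); apply: eq_bigr => l _.
  by rewrite scalerA mulrC divfK ?gt_eqF // /C ffunE.
rewrite normrZ (ger0_norm tm_ge0).
have T_le : T <= S%:R * t m.
  have lt_S : 2 * k%:R / c <= S%:R by rewrite ltW // truncnS_gt.
  apply: le_trans (ler_wpM2r tm_ge0 lt_S).
  by rewrite mulrAC ler_pdivlMr // [T * c]mulrC [_ * t m]mulrC ltW.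
have s_le (l : 'I_m) : 0 <= t l / t m <= S%:R.
  rewrite divr_ge0 //= ler_pdivrMr // (le_trans _ T_le) //.
  by rewrite /T (bigD1 l) //= lerDl sumr_ge0.
have := B_ok [ffun l : 'I_m => h l] (fun l => t l / t m) u s_le.
move=> /(ler_wpM2l tm_ge0); apply: le_trans; rewrite mulrA ler_wpM2r //.
have c'_le : c' * k%:R <= eta / (S%:R + 1).
  rewrite -ler_pdivlMr ?ltr0n // -mulrA -invfM mulrC (mulrC _ k%:R).
  by rewrite /c' ge_min mulrC lexx orbT.
apply: (@le_trans _ _ (eta / (S%:R + 1) * (S%:R * t m + t m))).
  by apply: ler_pM; rewrite ?mulr_ge0 ?addr_ge0 ?ler0n // lerD2r.
have S1 : S%:R + 1 != 0 :> R by rewrite gt_eqF // addr_gt0 ?ltr0n.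
have -> : S%:R * t m + t m = (S%:R + 1) * t m by rewrite mulrDl mul1r.
by rewrite mulrA divfK // mulrC.
Qed.

End General.

(** * Barycentric subdivision *)

Lemma cobd_eq0 (F : comNzRingType) (T : eqType) (phi : seq T -> F) s :
  (forall u, (size u).+1 = size s -> {subset u <= s} -> phi u = 0) -> cobd phi s = 0.
Proof.
elim: s phi => [|x s IHs] phi phi0 //=.
rewrite phi0 ?sub0r // => [|y y_s]; last by rewrite inE y_s orbT.
rewrite IHs ?oppr0 // => u sz_u sub_u; apply: phi0; first by rewrite /= sz_u.
by move=> y; rewrite !inE => /orP[->|/sub_u->] //; rewrite orbT.
Qed.

Lemma sum_const_seq (W : nmodType) (I : Type) (l : seq I) (c : W) :
  \sum_(i <- l) c = c *+ size l.
Proof. by rewrite big_const_seq count_predT iter_addr_0. Qed.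

Section Subdivision.
Variables (F : comNzRingType) (R : realType) (V : normedModType R) (G : zmodType).
Implicit Types (s t : seq (V * G)) (phi : seq (V * G) -> F) (Z : V -> Prop).

Definition mean (l : seq V) : V := (size l)%:R^-1 *: \sum_(v <- l) v.

(** The group component comes from the first vertex, which makes the map equivariant; the default
    [(0, 0)] concerns only the empty sequence. *)
Definition barycenter s : V * G := (mean (map fst s), (head (0, 0) s).2).

Definition mean_closed Z :=
  forall l, (0 < size l)%N -> (forall v, v \in l -> Z v) -> Z (mean l).

Definition diam_le (D : R) s := forall x y, x \in s -> y \in s -> `|x.1 - y.1| <= D.

Lemma mean_sub l (v : V) : (0 < size l)%N ->
  mean l - v = (size l)%:R^-1 *: \sum_(w <- l) (w - v).
Proof.
move=> l_gt0; rewrite /mean sumrB scalerBr sum_const_seq.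
by rewrite -(scaler_nat (size l) v) scalerA mulVf ?scale1r // pnatr_eq0 -lt0n.
Qed.

Lemma mean_closed_ball (v : V) (r : R) : mean_closed (fun w => `|w - v| <= r).
Proof.
move=> l l_gt0 l_r; rewrite mean_sub // normrZ ger0_norm ?invr_ge0 ?ler0n //.
rewrite ler_pdivrMl ?ltr0n // mulr_natl (le_trans (ler_norm_sum _ _ _)) //.
rewrite -sum_const_seq big_seq [leRHS]big_seq; exact: ler_sum.
Qed.

(** Among the differences to [x] that are averaged one is zero, whence the factor (m - 1) / m for m
    vertices. *)
Lemma barycenter_dist s D x : diam_le D s -> x \in s ->
  `|(barycenter s).1 - x.1| <= (size s).-1%:R / (size s)%:R * D.
Proof.
move=> sD x_s; have s_gt0 : (0 < size s)%N by case: s x_s {sD}.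
rewrite mean_sub ?size_map // normrZ ger0_norm ?invr_ge0 ?ler0n //.
rewrite mulrAC mulrC ler_wpM2r ?invr_ge0 ?ler0n //.
rewrite big_map (big_rem x) //= subrr add0r (le_trans (ler_norm_sum _ _ _)) //.
rewrite -(size_rem x_s) mulr_natl -sum_const_seq big_seq [leRHS]big_seq.
rewrite ler_sum // => y y_s.
by apply: sD => //; apply: mem_rem y_s.
Qed.

(** One subdivision shrinks diameters by [kappa]. The induction follows the nested cones: at each
    stage [Z] is cut down to the ball around the current barycenter, so that all later vertices stay
    within [kappa * D] of it. *)
Lemma subdivision_eq0 phi s Z D kappa : mean_closed Z ->
  (size s).-1%:R / (size s)%:R <= kappa -> 0 <= D ->
  diam_le D s -> (forall x, x \in s -> Z x.1) ->
  (forall t, size t = size s -> (forall x, x \in t -> Z x.1) ->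
     diam_le (kappa * D) t -> phi t = 0) ->
  cone_op barycenter phi s = 0.
Proof.
have [n] := ubnP (size s); elim: n s phi Z => // n IHn [|x s] phi Z.
  by move=> _ _ _ _ _ _ phi0; apply: phi0.
move=> lt_n Zmean le_kappa D_ge0 sD sZ phi0; rewrite cone_op_cons.
apply: cobd_eq0 => u [sz_u] sub_u; set q := barycenter _.
have q_close y : y \in x :: s -> `|q.1 - y.1| <= kappa * D.
  by move=> /(barycenter_dist sD)/le_trans-> //; rewrite ler_wpM2r.
apply: (IHn _ _ (fun v => Z v /\ `|v - q.1| <= kappa * D)).
- by rewrite sz_u.
- move=> l l_gt0 l_Z; split; first by apply: Zmean => // v /l_Z[].
  by apply: mean_closed_ball => // v /l_Z[].
- apply: le_trans le_kappa; rewrite sz_u /=.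
  case: (size s) => [|m]; first by rewrite !mul0r.
  by rewrite /= ler_pdivrMr ?ltr0n // mulrAC ler_pdivlMr ?ltr0n // -!natrM ler_nat; nia.
- exact: D_ge0.
- by move=> y z y_u z_u; apply: sD; apply: sub_u.
- by move=> y y_u; split; [apply: sZ|rewrite distrC; apply: q_close]; apply: sub_u.
move=> t sz_t t_Z tD; apply: phi0; first by rewrite /= sz_t sz_u.
  move=> y; rewrite inE => /orP[/eqP->|/t_Z[]//].
  apply: Zmean; rewrite ?size_map // => v /mapP[z z_s ->].
  exact: sZ.
have kD_ge0 : 0 <= kappa * D.
  by rewrite (le_trans _ (q_close x (mem_head _ _))).
move=> y z; rewrite !inE => /orP[/eqP->|y_t] /orP[/eqP->|z_t].
- by rewrite subrr normr0.
- by rewrite distrC; have [] := t_Z z z_t.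
- by have [] := t_Z y y_t.
exact: tD.
Qed.

Lemma iter_subdivision_eq0 r N phi s Z D (kappa := N%:R / N.+1%:R : R) :
  mean_closed Z -> size s = N.+1 -> 0 <= D -> diam_le D s ->
  (forall x, x \in s -> Z x.1) ->
  (forall t, size t = N.+1 -> (forall x, x \in t -> Z x.1) ->
     diam_le (kappa ^+ r * D) t -> phi t = 0) ->
  iter r (cone_op barycenter) phi s = 0.
Proof.
move=> Zmean; elim: r D s => [|r IHr] D s sz_s D_ge0 sD sZ phi0 /=.
  by apply: phi0; rewrite ?expr0 ?mul1r.
apply: (subdivision_eq0 (kappa := kappa) Zmean _ D_ge0 sD sZ); rewrite ?sz_s //.
move=> t sz_t tZ tD; apply: (IHr (kappa * D)) => //.
  by rewrite mulr_ge0 // divr_ge0 ?ler0n.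
move=> u sz_u uZ uD; apply: phi0 => //.
by rewrite exprSr -mulrA.
Qed.

Lemma convex_hull_mean_closed m (B : 'I_m -> V) :
  mean_closed (fun v => exists t : 'I_m -> R,
    [/\ forall l, 0 <= t l, \sum_l t l = 1 & v = \sum_l t l *: B l]).
Proof.
move=> l l_gt0 /= l_hull.
have [t t_ok] : exists t : V -> 'I_m -> R, forall v, v \in l ->
    [/\ forall i, 0 <= t v i, \sum_i t v i = 1 & v = \sum_i t v i *: B i].
  suff /choice[t t_ok] : forall v, exists t : 'I_m -> R, v \in l ->
      [/\ forall i, 0 <= t i, \sum_i t i = 1 & v = \sum_i t i *: B i] by exists t.
  move=> v; have [/l_hull[t t_ok]|_] := boolP (v \in l); first by exists t.
  by exists (fun=> 0).
exists (fun i => (size l)%:R^-1 * \sum_(v <- l) t v i); split=> [i||].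
- rewrite mulr_ge0 ?invr_ge0 ?ler0n // big_seq sumr_ge0 // => v /t_ok[t_ge0 _ _].
  exact: t_ge0.
- rewrite -big_distrr /= exchange_big /= big_seq.
  rewrite (eq_bigr (fun=> 1)) => [|v /t_ok[_ -> _]//].
  rewrite -big_seq sum_const_seq mulVf //.
  by rewrite pnatr_eq0 -lt0n.
rewrite /mean; under [RHS]eq_bigr do rewrite -scalerA scaler_suml.
rewrite -scaler_sumr exchange_big /=; congr (_ *: _).
by rewrite big_seq [RHS]big_seq; apply: eq_bigr => v /t_ok[_ _ {1}->].
Qed.

End Subdivision.

(** * Polar factors *)

Section Bilinear.
Variable R : realType.

Definition bil m (Q : 'M[R]_m) (x y : 'cV[R]_m) : R := (x^T *m Q *m y) 0 0.

Lemma bilDl m (Q : 'M[R]_m) x x' y : bil Q (x + x') y = bil Q x y + bil Q x' y.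
Proof. by rewrite /bil linearD !mulmxDl mxE. Qed.

Lemma bilDr m (Q : 'M[R]_m) x y y' : bil Q x (y + y') = bil Q x y + bil Q x y'.
Proof. by rewrite /bil mulmxDr mxE. Qed.

Lemma bilZl m (Q : 'M[R]_m) a x y : bil Q (a *: x) y = a * bil Q x y.
Proof. by rewrite /bil linearZ -!scalemxAl mxE. Qed.

Lemma bilZr m (Q : 'M[R]_m) a x y : bil Q x (a *: y) = a * bil Q x y.
Proof. by rewrite /bil -scalemxAr mxE. Qed.

Lemma bil0l m (Q : 'M[R]_m) y : bil Q 0 y = 0.
Proof. by rewrite /bil trmx0 !mul0mx mxE. Qed.

Lemma bil0r m (Q : 'M[R]_m) x : bil Q x 0 = 0.
Proof. by rewrite /bil mulmx0 mxE. Qed.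

Lemma bilC m (Q : 'M[R]_m) x y : Q^T = Q -> bil Q x y = bil Q y x.
Proof.
move=> QT; rewrite /bil -[in RHS]QT -[in RHS](trmxK x) -!trmx_mul mulmxA.
by rewrite [RHS]mxE.
Qed.

Lemma bil_delta m (Q : 'M[R]_m) i j : bil Q (delta_mx i 0) (delta_mx j 0) = Q i j.
Proof. by rewrite /bil trmx_delta -rowE -colE !mxE. Qed.

Lemma trace_bil m (Q : 'M[R]_m) x y : \tr (x *m y^T *m Q) = bil Q y x.
Proof. by rewrite -mulmxA mxtrace_mulC /bil /mxtrace big_ord1. Qed.

Definition dotp m (x y : 'cV[R]_m) := bil 1%:M x y.

Lemma dotpE m (x y : 'cV[R]_m) : dotp x y = \sum_i x i 0 * y i 0.
Proof. by rewrite /dotp /bil mulmx1 mxE; apply: eq_bigr => i _; rewrite mxE. Qed.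

Lemma dotpC m (x y : 'cV[R]_m) : dotp x y = dotp y x.
Proof. by rewrite /dotp bilC ?trmx1. Qed.

Lemma dotp_ge0 m (x : 'cV[R]_m) : 0 <= dotp x x.
Proof. by rewrite dotpE sumr_ge0 // => i _; rewrite -expr2 sqr_ge0. Qed.

Lemma dotp_gt0 m (x : 'cV[R]_m) : x != 0 -> 0 < dotp x x.
Proof.
move=> x_neq0; rewrite lt_neqAle dotp_ge0 andbT eq_sym dotpE.
rewrite psumr_eq0 => [|i _]; last by rewrite -expr2 sqr_ge0.
apply: contraNN x_neq0 => /allP x0; apply/eqP/matrixP => i j; rewrite (ord1 j) mxE.
by apply/eqP; have := x0 i (mem_index_enum i); rewrite -expr2 sqrf_eq0.
Qed.

Lemma bilQB m (Q Q' : 'M[R]_m) x y : bil (Q - Q') x y = bil Q x y - bil Q' x y.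
Proof.
rewrite /bil mulmxBr mulmxBl; move: (_ *m y) (_ *m y) => X Y.
by rewrite mxE [X in _ + X]mxE.
Qed.

Lemma bilQZ m a (Q : 'M[R]_m) x y : bil (a *: Q) x y = a * bil Q x y.
Proof. by rewrite /bil -scalemxAr -scalemxAl mxE. Qed.

Lemma bil_rank1 m (Q : 'M[R]_m) x y v w :
  bil (x *m y^T *m Q) v w = dotp v x * bil Q y w.
Proof.
rewrite /bil -(mulmxA x) mulmxA -(mulmxA (v^T *m x)) mxE big_ord1.
by rewrite /dotp /bil mulmx1.
Qed.

Lemma norm_sqr_le_dotp m (x : 'cV[R]_m) : `|x| ^+ 2 <= dotp x x.
Proof.
have [->|x_neq0] := eqVneq x 0; first by rewrite normr0 expr0n dotp_ge0.
have [q ->] := mx_norm_attained x_neq0; rewrite real_normK ?num_real // dotpE.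
by rewrite (bigD1 q) //= -expr2 lerDl sumr_ge0 // => i _; rewrite -expr2 sqr_ge0.
Qed.

Lemma dotp_le m (x : 'cV[R]_m) : dotp x x <= m%:R * `|x| ^+ 2.
Proof.
rewrite dotpE mulr_natl -[X in _ *+ X]card_ord -sumr_const ler_sum // => i _.
by rewrite -expr2 -[leLHS]real_normK ?num_real // lerXn2r ?nnegrE ?le_mx_norm.
Qed.

Lemma bil_le m (Q : 'M[R]_m) x : bil Q x x <= m%:R ^+ 2 * `|Q| * `|x| ^+ 2.
Proof.
rewrite (le_trans (ler_norm _)) // (le_trans (le_mx_norm _ _ _)) //.
rewrite (le_trans (mx_norm_mul _ _)) //.
have -> : m%:R ^+ 2 * `|Q| * `|x| ^+ 2 = m%:R * (m%:R * `|x| * `|Q|) * `|x|.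
  by ring.
rewrite ler_wpM2r // ler_wpM2l ?ler0n // (le_trans (mx_norm_mul _ _)) //.
rewrite ler_wpM2r // ler_wpM2l ?ler0n // mx_norm_le // => i j.
by rewrite mxE le_mx_norm.
Qed.

(** For nonzero [v], the Householder reflection in the hyperplane orthogonal to [v]. *)
Definition refl m (v : 'cV[R]_m) : 'M[R]_m := 1%:M - (2 / dotp v v) *: (v *m v^T).

Lemma refl_tr m (v : 'cV[R]_m) : (refl v)^T = refl v.
Proof. by rewrite /refl linearB linearZ /= trmx1 trmx_mul trmxK. Qed.

Lemma refl_refl m (v : 'cV[R]_m) : v != 0 -> refl v *m refl v = 1%:M.
Proof.
move=> v_neq0; have vv := dotp_gt0 v_neq0.
have E : (v *m v^T) *m (v *m v^T) = dotp v v *: (v *m v^T).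
  rewrite mulmxA -(mulmxA v) -[v^T *m v]mulmx1.
  have -> : v^T *m v *m 1%:M = (dotp v v)%:M.
    by apply/matrixP => i j; rewrite !ord1 mulmx1 /dotp /bil mulmx1 !mxE mulr1n.
  by rewrite mul_mx_scalar -scalemxAl.
rewrite /refl mulmxBl mul1mx mulmxBr mulmx1 -scalemxAl -scalemxAr E !scalerA.
set P := v *m v^T; apply/matrixP => i j; rewrite !mxE; field.
by rewrite gt_eqF.
Qed.

Lemma trace_refl m (v : 'cV[R]_m) Q : \tr (refl v *m Q) = \tr Q - 2 / dotp v v * bil Q v v.
Proof.
by rewrite /refl mulmxBl mul1mx linearB /= -scalemxAl linearZ /= trace_bil.
Qed.

End Bilinear.

Lemma quadratic_eq0 (R : realType) (b K : R) : (forall e, e * b <= e ^+ 2 * K) -> b = 0.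
Proof.
move=> quad; apply/eqP/negPn/negP => b_neq0.
have L_gt0 : 0 < `|K| + 1 by rewrite ltr_wpDl.
have := quad (b / (`|K| + 1)); apply/negP; rewrite -ltNge.
have -> : b / (`|K| + 1) * b = (b / (`|K| + 1)) ^+ 2 * (`|K| + 1).
  by field; rewrite gt_eqF.
have e_neq0 : b / (`|K| + 1) != 0 by rewrite mulf_neq0 // invr_neq0 // gt_eqF.
rewrite ltr_pM2l; last by rewrite exprn_even_gt0.
by rewrite (le_lt_trans (ler_norm _)) // ltrDl.
Qed.

Section Polar.
Variables (R : realType) (n k : nat).
Implicit Types (A U : 'M[R]_(n, k)).

Definition isometric U : Prop := U^T *m U = 1%:M.

(** The isometric factor of the polar decomposition in variational form: existence follows from
    compactness, and the properties of U^T A from comparing [U] with its products with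
    reflections. *)
Definition polar A U := isometric U /\
  forall U', isometric U' -> \tr (U'^T *m A) <= \tr (U^T *m A).

Lemma isometry_dotp U x y : isometric U -> dotp (U *m x) (U *m y) = dotp x y.
Proof.
move=> Uiso; rewrite /dotp /bil !mulmx1 trmx_mul mulmxA -(mulmxA x^T) Uiso.
by rewrite mulmx1.
Qed.

Lemma isometry_entry_le U i j : isometric U -> `|U i j| <= 1.
Proof.
move=> Uiso; have Ujj : \sum_l U l j ^+ 2 = 1.
  transitivity ((U^T *m U) j j); last by rewrite Uiso mxE eqxx.
  by rewrite mxE; apply: eq_bigr => l _; rewrite mxE.
rewrite -(expr_le1 (n := 2)) // real_normK ?num_real // -Ujj (bigD1 i) //= lerDl.
by rewrite sumr_ge0 // => l _; rewrite sqr_ge0.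
Qed.

Lemma isometry_mulr U (H : 'M[R]_k) : isometric U -> H^T *m H = 1%:M -> isometric (U *m H).
Proof. by move=> Uiso HH; rewrite /isometric trmx_mul mulmxA -(mulmxA _ U^T) Uiso mulmx1. Qed.

Lemma isometry_mull U (H : 'M[R]_n) : isometric U -> H^T *m H = 1%:M -> isometric (H *m U).
Proof. by move=> Uiso HH; rewrite /isometric trmx_mul mulmxA -(mulmxA _ H^T) HH mulmx1. Qed.

Lemma polar_mul A U (H : 'M[R]_k) : H *m H^T = 1%:M -> H^T *m H = 1%:M ->
  polar A U -> polar (A *m H) (U *m H).
Proof.
move=> HH HH' [Uiso Umax]; split; first exact: isometry_mulr.
move=> U' U'iso; have isoUH : isometric (U' *m H^T) by apply: isometry_mulr; rewrite ?trmxK.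
have := Umax _ isoUH; rewrite trmx_mul trmxK -mulmxA mxtrace_mulC -mulmxA => /le_trans-> //.
by rewrite [leRHS](_ : _ = \tr (U^T *m A)) // trmx_mul mulmxA mxtrace_mulC !mulmxA HH mul1mx.
Qed.

Section Factor.
Variables (A U : 'M[R]_(n, k)).
Hypothesis polarAU : polar A U.
Let Q := U^T *m A.

(** Replacing [U] by [U *m refl x] subtracts a positive multiple of [bil Q x x] from the maximal
    trace. *)
Lemma polar_psd x : 0 <= bil Q x x.
Proof.
have [->|x_neq0] := eqVneq x 0; first by rewrite /bil mulmx0 mxE.
have [Uiso Umax] := polarAU.
have := Umax _ (isometry_mulr Uiso (_ : (refl x)^T *m refl x = 1%:M)).
rewrite refl_tr refl_refl // => /(_ erefl).
rewrite trmx_mul refl_tr -mulmxA trace_refl gerBl pmulr_rge0 //.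
by rewrite divr_gt0 // dotp_gt0.
Qed.

(* Maximality against the product of the reflections in [v] and [v + e x],
   to first order in [e]. *)
Lemma polar_sym : Q^T = Q.
Proof.
have [Uiso Umax] := polarAU.
have double v w : 2 * dotp v w * bil Q w v <=
    dotp w w * bil Q v v + dotp v v * bil Q w w.
  have [->|v_neq0] := eqVneq v 0.
    by rewrite /dotp !(bil0l, bil0r, mulr0, mul0r) addr0.
  have [->|w_neq0] := eqVneq w 0.
    by rewrite /dotp !(bil0l, bil0r, mulr0, mul0r) addr0.
  have H_orth x : x != 0 -> (refl x)^T *m refl x = 1%:M :> 'M[R]_k.
    by move=> x_neq0; rewrite refl_tr refl_refl.
  have := Umax _ (isometry_mulr (isometry_mulr Uiso (H_orth w w_neq0)) (H_orth v v_neq0)).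
  rewrite !trmx_mul !refl_tr -!mulmxA !trace_refl -/Q.
  have -> : bil (refl w *m Q) v v = bil Q v v - 2 / dotp w w * (dotp v w * bil Q w v).
    by rewrite /refl mulmxBl mul1mx bilQB -scalemxAl bilQZ bil_rank1.
  have vv := dotp_gt0 v_neq0; have ww := dotp_gt0 w_neq0.
  move: (dotp v v) (dotp w w) (dotp v w) vv ww (\tr Q) => a b e vv ww T.
  move: (bil Q v v) (bil Q w w) (bil Q w v) => qv qw qwv le_T.
  have : 0 <= 2 / (a * b) * (b * qv + a * qw - 2 * e * qwv).
    have -> : 2 / (a * b) * (b * qv + a * qw - 2 * e * qwv) =
        T - (T - 2 / b * qw - 2 / a * (qv - 2 / b * (e * qwv))).
      by field; rewrite !gt_eqF.
    by rewrite subr_ge0.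
  by rewrite pmulr_rge0 ?subr_ge0 // divr_gt0 ?mulr_gt0.
apply/matrixP => i j; rewrite mxE -!bil_delta.
set v := delta_mx i 0; set x := delta_mx j 0.
have vv : dotp v v = 1 by rewrite /dotp bil_delta mxE eqxx.
have first_order e : e * (bil Q x v - bil Q v x) <=
    e ^+ 2 * (dotp x x * bil Q v v + bil Q x x - 2 * dotp v x * bil Q x v).
  have := double v (v + e *: x).
  rewrite /dotp !(bilDl, bilDr, bilZl, bilZr) -!/(dotp _ _) (dotpC x v) vv.
  move: (bil Q v v) (bil Q x v) (bil Q v x) (bil Q x x) (dotp v x) (dotp x x) => *.
  lra.
by apply/eqP; rewrite -subr_eq0; apply/eqP; apply: quadratic_eq0 first_order.
Qed.

(** Reflections on the left show that A U^T is positive semidefinite. A column [w] of A - U Q is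
    orthogonal to the image of [U], and [ortho] then makes it orthogonal to itself. *)
Lemma polar_factor : A = U *m Q.
Proof.
have [Uiso Umax] := polarAU.
have psd w : 0 <= bil (A *m U^T) w w.
  have [->|w_neq0] := eqVneq w 0; first by rewrite bil0r.
  have := Umax _ (isometry_mull Uiso (_ : (refl w)^T *m refl w = 1%:M)).
  rewrite refl_tr refl_refl // => /(_ erefl).
  rewrite trmx_mul refl_tr mxtrace_mulC mulmxA mxtrace_mulC trace_refl.
  rewrite [\tr (A *m _)]mxtrace_mulC gerBl pmulr_rge0 //.
  by rewrite divr_gt0 // dotp_gt0.
(* If [U^T w = 0], the quadratic form vanishes at [w], so its minimality there
   kills the mixed term [w^T A x]. *)
have ortho (w : 'cV[R]_n) (x : 'cV[R]_k) : U^T *m w = 0 -> (w^T *m A *m x) 0 0 = 0.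
  move=> Uw; have AUw y : bil (A *m U^T) y w = 0.
    by rewrite /bil -mulmxA -(mulmxA A) Uw !mulmx0 mxE.
  have AUx y : bil (A *m U^T) y (U *m x) = (y^T *m A *m x) 0 0.
    rewrite /bil -(mulmxA y^T) -(mulmxA A U^T) [U^T *m _]mulmxA Uiso mul1mx.
    by rewrite mulmxA.
  set b := _ 0 0.
  have quad e : 0 <= e * b + e ^+ 2 * bil (A *m U^T) (U *m x) (U *m x).
    have := psd (w + e *: (U *m x)).
    by rewrite !(bilDl, bilDr, bilZl, bilZr) !AUw AUx -/b; lra.
  apply: (@quadratic_eq0 _ b (bil (A *m U^T) (U *m x) (U *m x))) => e.
  by have := quad (- e); rewrite sqrrN; lra.
have UD : U^T *m (A - U *m Q) = 0 by rewrite mulmxBr mulmxA Uiso mul1mx subrr.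
apply/eqP; rewrite -subr_eq0; apply/eqP/matrixP => i j; rewrite [RHS]mxE.
pose w := (A - U *m Q) *m (delta_mx j 0 : 'cV[R]_k).
have Uw : U^T *m w = 0 by rewrite mulmxA UD mul0mx.
have [w0|/dotp_gt0] := eqVneq w 0.
  by move/matrixP/(_ i 0): w0; rewrite /w -colE !mxE.
have wU : w^T *m U = 0 by rewrite -[LHS]trmxK trmx_mul trmxK Uw trmx0.
suff -> : dotp w w = 0 by rewrite ltxx.
have w_eq : w = A *m delta_mx j 0 - U *m (Q *m delta_mx j 0).
  by rewrite /w mulmxBl -(mulmxA U).
rewrite /dotp /bil mulmx1 {2}w_eq mulmxBr [w^T *m (U *m _)]mulmxA wU mul0mx subr0.
by rewrite mulmxA ortho.
Qed.

(* [A^T A >= c^2 / (k + 1)] and [Q <= n C k^2 + 1], so this bounds [Q = sqrt(A^T A)]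
   below. *)
Definition polar_mod (c C : R) : R := c ^+ 2 / (k.+1%:R * (n%:R * C * k%:R ^+ 2 + 1)).

(** Positivity of [Q] at w - Q w / B together with Q <= B gives Q >= Q^2 / B, and Q^2 = A^T A is
    bounded below by the hypothesis on [A]. *)
Lemma polar_lower c C w : 0 < c -> 0 <= C -> `|A| <= C ->
  (forall x : 'cV[R]_k, c * `|x| <= `|A *m x|) ->
  polar_mod c C * dotp w w <= bil Q w w.
Proof.
move=> c_gt0 C_ge0 A_le A_ge; have [Uiso _] := polarAU.
pose B := n%:R * C * k%:R ^+ 2 + 1.
have B_gt0 : 0 < B by rewrite ltr_wpDl ?mulr_ge0 ?ler0n.
have bil_le x : bil Q x x <= B * dotp x x.
  have Q_le : `|Q| <= n%:R * C.
    rewrite (le_trans (mx_norm_mul _ _)) //.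
    rewrite ler_pM ?mulr_ge0 ?ler0n // ler_piMr ?ler0n //.
    by apply: mx_norm_le => // i' j'; rewrite mxE; apply: isometry_entry_le.
  apply: (@le_trans _ _ (n%:R * C * k%:R ^+ 2 * dotp x x)); last first.
    by rewrite ler_wpM2r ?dotp_ge0 // lerDl.
  rewrite (le_trans (bil_le _ _)) // ler_pM ?mulr_ge0 ?sqr_ge0 //.
    by rewrite mulrC ler_wpM2r ?sqr_ge0.
  exact: norm_sqr_le_dotp.
have Qsym := polar_sym.
have QQ : bil Q (Q *m w) w = dotp (Q *m w) (Q *m w).
  by rewrite bilC // /dotp /bil mulmx1 trmx_mul Qsym mulmxA.
have AA : dotp (Q *m w) (Q *m w) = dotp (A *m w) (A *m w).
  by rewrite [in RHS]polar_factor -(mulmxA U) isometry_dotp.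
have wA : c ^+ 2 / k.+1%:R * dotp w w <= dotp (A *m w) (A *m w).
  apply: (@le_trans _ _ (c ^+ 2 * `|w| ^+ 2)).
    rewrite -mulrA ler_wpM2l ?sqr_ge0 // mulrC ler_pdivrMr ?ltr0n //.
    by rewrite (le_trans (dotp_le _)) // mulrC ler_wpM2l ?sqr_ge0 // ler_nat.
  rewrite -exprMn (@le_trans _ _ (`|A *m w| ^+ 2)) //.
    by rewrite lerXn2r ?nnegrE ?mulr_ge0 // ltW.
  exact: norm_sqr_le_dotp.
have := polar_psd (w - B^-1 *: (Q *m w)).
rewrite -scaleNr bilDl !bilDr !(bilZl, bilZr) (bilC w) // !QQ.
have := bil_le (Q *m w).
rewrite AA => le1 psd.
have B_ge0 := ltW B_gt0.
have z_le : B^-1 * dotp (A *m w) (A *m w) <= bil Q w w.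
  have : B^-1 * (B^-1 * bil Q (Q *m w) (Q *m w)) <= B^-1 * dotp (A *m w) (A *m w).
    by rewrite ler_wpM2l ?invr_ge0 // ler_pdivrMl.
  lra.
apply: le_trans z_le; rewrite /polar_mod -/B invfM mulrA mulrAC mulrC.
by rewrite ler_wpM2l ?invr_ge0.
Qed.

End Factor.

(** With D = U - U' and Q = U^T A, twice the trace of D^T A is the trace of D Q D^T, which
    [polar_lower] bounds below by a multiple of the squared norm of D. Adding the analogous bound
    for A' leaves the trace of D^T (A - A'). *)
Lemma polar_lipschitz A A' U U' c C : 0 < c -> 0 <= C ->
  `|A| <= C -> `|A'| <= C ->
  (forall x : 'cV[R]_k, c * `|x| <= `|A *m x|) ->
  (forall x : 'cV[R]_k, c * `|x| <= `|A' *m x|) ->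
  polar A U -> polar A' U' ->
  polar_mod c C * `|U - U'| <= n%:R * k%:R * `|A - A'|.
Proof.
move=> c_gt0 C_ge0 A_le A'_le A_ge A'_ge AU A'U'.
have mod_ge0 : 0 <= polar_mod c C.
  by rewrite divr_ge0 ?sqr_ge0 // mulr_ge0 ?ler0n // addr_ge0 // !mulr_ge0 ?ler0n // sqr_ge0.
pose D := U - U'.
have traceD (B : 'M[R]_(n, k)) (W W' : 'M[R]_(n, k)) : polar B W -> isometric W' ->
    \tr ((W - W') *m (W^T *m B) *m (W - W')^T) = 2 * \tr ((W - W')^T *m B).
  move=> BW W'iso; have [Wiso _] := BW; have Qsym := polar_sym BW.
  have BE := polar_factor BW.
  have [Q EQ] : exists Q, W^T *m B = Q by exists (W^T *m B).
  rewrite EQ in Qsym BE *.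
  rewrite mxtrace_mulC mulmxA -(mulmxA _ _ Q) mulmxBl -BE.
  have ET : (W - W')^T = W^T - W'^T by rewrite linearB.
  have trW : \tr (W^T *m (W' *m Q)) = \tr (W'^T *m B).
    rewrite -mxtrace_tr !trmx_mul trmxK Qsym -mulmxA mxtrace_mulC -mulmxA.
    by rewrite -BE.
  rewrite mulmxBr ET !mulmxBl [W'^T *m (W' *m Q)]mulmxA W'iso mul1mx.
  by rewrite !raddfB /= trW EQ mulr_natl mulr2n; lra.
have lower (B : 'M[R]_(n, k)) W W' : `|B| <= C -> polar B W -> isometric W' ->
    (forall x : 'cV[R]_k, c * `|x| <= `|B *m x|) ->
    polar_mod c C * `|W - W'| ^+ 2 <= 2 * \tr ((W - W')^T *m B).
  move=> B_le BW W'iso B_ge; rewrite -traceD // /mxtrace.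
  set E := W - W'.
  have rowE i : (E *m (W^T *m B) *m E^T) i i =
      bil (W^T *m B) (row i E)^T (row i E)^T.
    rewrite /bil trmxK -row_mul [LHS]mxE [RHS]mxE; apply: eq_bigr => j _.
    by rewrite [row i _ _ _]mxE [E^T _ _]mxE [_^T j _]mxE [row i E _ _]mxE.
  under eq_bigr do rewrite rowE.
  apply: (@le_trans _ _ (\sum_i polar_mod c C * dotp (row i E)^T (row i E)^T)).
    rewrite -big_distrr /= ler_wpM2l //.
    have [->|E_neq0] := eqVneq E 0.
      by rewrite normr0 expr0n /= sumr_ge0 // => i _; apply: dotp_ge0.
    have E0 : mx_norm E != 0 by rewrite -[mx_norm E]/(`|E|) normr_eq0.
    have [[i j] /= E_ij] := mx_norm_neq0 E0; rewrite -[`|E|]/(mx_norm E) E_ij.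
    rewrite real_normK ?num_real // (bigD1 i) //= (dotpE (row i E)^T) (bigD1 j) //=.
    rewrite !mxE -expr2 -addrA lerDl addr_ge0 ?sumr_ge0 // => l _; last exact: dotp_ge0.
    by rewrite -expr2 sqr_ge0.
  by apply: ler_sum => i _; apply: polar_lower.
have := lower A U U' A_le AU A'U'.1 A_ge.
have := lower A' U' U A'_le A'U' AU.1 A'_ge.
rewrite [`|U' - U|]distrC -/D.
have -> : (U' - U)^T = - D^T by rewrite -linearN opprB.
rewrite mulNmx raddfN /=.
have : \tr (D^T *m A) - \tr (D^T *m A') <= n%:R * k%:R * (`|D| * `|A - A'|).
  rewrite -raddfB -mulmxBr /= (le_trans (ler_norm _)) //.
  apply: (@le_trans _ _ (\sum_(j < k) n%:R * (`|D| * `|A - A'|))); last first.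
    by rewrite sumr_const card_ord -[leLHS]mulr_natl !mulrA [k%:R * _]mulrC lexx.
  rewrite (le_trans (ler_norm_sum _ _ _)) // ler_sum // => j _.
  rewrite (le_trans (le_mx_norm _ _ _)) // (le_trans (mx_norm_mul _ _)) //.
  rewrite -mulrA ler_wpM2l ?ler0n // ler_wpM2r // mx_norm_le // => i' j'.
  by rewrite mxE le_mx_norm.
move=> le1 le2 le3.
have [->|D_gt0] := eqVneq D 0; first by rewrite normr0 mulr0 mulr_ge0 ?mulr_ge0 ?ler0n.
rewrite -(ler_pM2l (_ : 0 < `|D|)) ?normr_gt0 //.
move: le1 le2 le3; rewrite expr2; move: `|D| `|A - A'| (polar_mod c C) (n%:R) (k%:R) => *.
lra.
Qed.

End Polar.

(** * Equivariance, flags and labels *)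

Lemma cone_op_equivariant (F : comNzRingType) (T P : Type) (b : seq T -> P)
    (h : T -> T) (h' : P -> P) (phi : seq P -> F) t :
  (forall x u, b (map h (x :: u)) = h' (b (x :: u))) ->
  cone_op b phi (map h t) = cone_op b (fun s => phi (map h' s)) t.
Proof.
move=> bh; have [n] := ubnP (size t); elim: n t phi => // n IHn [|x t] phi //= lt_n.
rewrite !cone_op_cons -map_cons bh cobd_map.
apply: (@eq_cobd_size _ _ _ _ (size t)) => // u sz_u.
by rewrite IHn // sz_u.
Qed.

Section HomotopyInvariance.
Variables (F : comNzRingType) (T P : Type) (D : (seq P -> F) -> seq T -> F).
Variables (q : T -> P) (h : T -> T) (h' : P -> P).
Hypothesis D_sub : forall phi psi t,
  D (fun s => phi s - psi s) t = D phi t - D psi t.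
Hypothesis D_equivariant : forall phi t, D phi (map h t) = D (fun s => phi (map h' s)) t.
Hypothesis q_equivariant : forall x, q (h x) = h' (q x).

Lemma htpy_equivariant phi t :
  htpy D q phi (map h t) = htpy D q (fun s => phi (map h' s)) t.
Proof.
have [n] := ubnP (size t); elim: n t phi => // n IHn [|x t] phi lt_n //.
rewrite [map h _]/= !htpy_cons -map_cons D_equivariant q_equivariant cobd_map.
congr (_ - _); apply: (@eq_cobd_size _ _ _ _ (size t)) => // u sz_u.
by rewrite IHn // sz_u.
Qed.

Lemma htpy0 t : htpy D q (fun=> 0) t = 0.
Proof.
rewrite -[RHS](subrr (htpy D q (fun=> 0) t)) -htpyB //; congr htpy.
by apply/funext => s; rewrite subrr.
Qed.

End HomotopyInvariance.

Section Flags.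
Variables (F : comNzRingType) (T P : Type) (pt : nat -> T -> P).

(** The apex depends only on the dimension and the first vertex of the simplex, so coning produces
    flags with exactly one vertex for each dimension. *)
Definition flag_point (t0 : T) (t : seq T) : P := pt (size t).-1 (head t0 t).

Fixpoint flag (g : nat -> T) m : seq P :=
  if m is m'.+1 then pt m' (g m') :: flag g m' else [::].

Lemma eq_flag g g' m : (forall l, (l < m)%N -> g l = g' l) -> flag g m = flag g' m.
Proof.
elim: m => //= m IHm E; rewrite E // IHm // => l lt_lm.
by apply: E; rewrite ltnW.
Qed.

Lemma size_flag g m : size (flag g m) = m.
Proof. by elim: m => //= m ->. Qed.

Lemma cone_flag_eq0 (t0 : T) (phi : seq P -> F) t :
  (forall g, phi (flag g (size t)) = 0) -> cone_op (flag_point t0) phi t = 0.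
Proof.
have [n] := ubnP (size t); elim: n t phi => // n IHn [|x t] phi lt_n phi0.
  exact: (phi0 (fun=> t0)).
rewrite cone_op_cons -[RHS](cobd0 _ (x :: t)).
apply: (@eq_cobd_size _ _ _ _ (size t)) => // u sz_u; rewrite IHn ?sz_u // => g.
have := phi0 (fun l => if l == size t then x else g l); rewrite /= eqxx.
by rewrite (@eq_flag _ g) // => l lt_l; rewrite ltn_eqF.
Qed.

End Flags.

Section CupLabelsMore.
Variable p : nat.
Hypothesis p_pr : prime p.
Local Notation F := 'F_p.

Lemma vdm_avoid (a : F) (s : seq F) : size s = p -> a \notin s -> vdm s = 0.
Proof.
move=> sz_s a_s; apply: vdm_repeat; apply/negP => Us.
have Uas : uniq (a :: s) by rewrite /= a_s Us.
have sub : {subset a :: s <= enum F} by move=> x _; rewrite mem_enum.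
by have := uniq_leq_size Uas sub; rewrite -cardE card_Fp //= sz_s ltnn.
Qed.

(** The block belonging to [l] has [p] vertices, so if the value [a] is missed, some label
    repeats. *)
Lemma cup_labels_avoid (P : eqType) (L : seq (P -> F)) l (a : F) s :
  List.In l L -> size s = (size L * p.-1).+1 ->
  (forall x, x \in s -> l x != a) -> cup_labels L s = 0.
Proof.
elim: L s => [|l' L IHL] s //= [->|L_l] sz_s s_a; rewrite /cup.
  rewrite (vdm_avoid (a := a)) ?mul0r //.
    by rewrite size_map size_takel ?prednK ?prime_gt0 // sz_s mulSn; lia.
  by apply/mapP => -[x /mem_take x_s Ea]; have := s_a x x_s; rewrite -Ea eqxx.
rewrite (IHL (drop p.-1 s)) ?mulr0 // => [|x /mem_drop]; last exact: s_a.
by rewrite size_drop sz_s mulSn -addnS addKn.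
Qed.

Lemma eq_cup_labels_translate (I T P : Type) (r : seq I) (h : T -> P)
    (lam : I -> P -> F) (chi : I -> T -> F) (const : I -> F) s :
  (forall i x, lam i (h x) = const i + chi i x) ->
  cup_labels [seq lam i | i <- r] (map h s) = cup_labels [seq chi i | i <- r] s.
Proof.
move=> E; elim: r s => [|i r IHr] s //=; rewrite /cup -map_take -map_drop IHr.
congr (_ * _); rewrite -[RHS](vdm_shift (const i)) -!map_comp.
by congr vdm; apply: eq_map => x /=.
Qed.

Lemma eq_cup_labels_shift (I P : Type) (r : seq I) (h : P -> P)
    (lam : I -> P -> F) (const : I -> F) s :
  (forall i x, lam i (h x) = const i + lam i x) ->
  cup_labels [seq lam i | i <- r] (map h s) = cup_labels [seq lam i | i <- r] s.
Proof. exact: eq_cup_labels_translate. Qed.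

End CupLabelsMore.

(** * Compactness of the Stiefel manifold *)

Local Open Scope classical_set_scope.

Lemma sum_continuous (R : realType) (T : topologicalType) (I : finType) (h : I -> T -> R) :
  (forall i, continuous (h i)) -> continuous (fun x => \sum_i h i x).
Proof. by move=> h_cont; apply: continuous_big => // z; apply: add_continuous. Qed.

Section Stiefel.
Variables (R : realType) (n k : nat).
Local Notation stiefel := [set U : 'M[R]_(n, k) | isometric U].

Lemma vec_mx_continuous : continuous (@vec_mx R n k).
Proof.
move=> v S /nbhs_ballP[e e_gt0 e_S]; apply/nbhs_ballP; exists e => //= w.
rewrite -ball_normE /ball_ /= => lt_e; apply: e_S; rewrite -ball_normE /ball_ /=.
apply: le_lt_trans lt_e; rewrite -linearB.
by apply: mx_norm_le => // i j; rewrite mxE le_mx_norm.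
Qed.

Lemma stiefel_closed : closed stiefel.
Proof.
have -> : stiefel = \bigcap_(ij in [set: 'I_k * 'I_k])
    ((fun U : 'M[R]_(n, k) => \sum_l U l ij.1 * U l ij.2) @^-1`
      [set (ij.1 == ij.2)%:R]).
  apply/seteqP; split=> U /=.
    move=> Uiso [i j] _ /=; have /matrixP/(_ i j) := Uiso; rewrite !mxE => <-.
    by apply: eq_bigr => l _; rewrite mxE.
  move=> H; apply/matrixP => i j; rewrite !mxE -(H (i, j) I) /=.
  by apply: eq_bigr => l _; rewrite mxE.
apply: closed_bigI => -[i j] _ /=; apply: closed_comp; last exact: closed_eq.
move=> U _; apply: sum_continuous => l V.
exact: cvgM (@coord_continuous R n k l i V) (@coord_continuous R n k l j V).
Qed.

Lemma stiefel_compact : compact stiefel.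
Proof.
pose box : set 'rV[R]_(n * k) := [set v | forall i, `[(-1 : R), 1] (v ord0 i)].
have box_compact : compact box.
  by apply: (@rV_compact _ _ (fun=> `[(-1 : R), 1]%classic)) => i; apply: segment_compact.
have img_compact : compact (@vec_mx R n k @` box).
  apply: continuous_compact box_compact.
  by apply: continuous_subspaceT; exact: vec_mx_continuous.
apply: (subclosed_compact stiefel_closed img_compact) => U Uiso.
exists (mxvec U); last exact: mxvecK.
move=> l /=; case/mxvec_indexP: l => i j; rewrite mxvecE in_itv /= -ler_norml.
exact: isometry_entry_le.
Qed.

Lemma polar_exists A : (k <= n)%N -> exists U : 'M[R]_(n, k), polar A U.
Proof.
move=> le_kn.
have st_neq0 : stiefel !=set0.
  exists (pid_mx k); rewrite /= /isometric tr_pid_mx mul_pid_mx minnn (minn_idPr le_kn).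
  exact: pid_mx_1.
have tr_cont : {within stiefel, continuous (fun U : 'M[R]_(n, k) => \tr (U^T *m A))}.
  apply: continuous_subspaceT => U.
  have -> : (fun U : 'M[R]_(n, k) => \tr (U^T *m A)) =
      (fun U => \sum_j \sum_i U i j * A i j).
    apply/funext => W; apply: eq_bigr => j _; rewrite mxE.
    by apply: eq_bigr => i _; rewrite mxE.
  apply: sum_continuous => j; apply: sum_continuous => i V.
  exact: cvgM (@coord_continuous R n k i j V) (cvg_cst _).
have [U /set_mem Uiso Umax] := compact_EVT_max st_neq0 stiefel_compact tr_cont.
by exists U; split=> // U' U'iso; apply: Umax; apply/mem_set.
Qed.

End Stiefel.

Section Sphere.
Variables (R : realType).

Lemma euclid_norm_dotp m (x : 'cV[R]_m) : euclid_norm x = Num.sqrt (dotp x x).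
Proof. by rewrite dotpE; congr Num.sqrt; apply: eq_bigr => i _; rewrite expr2. Qed.

Lemma isometry_euclid_norm n k (U : 'M[R]_(n, k)) x :
  isometric U -> euclid_norm (U *m x) = euclid_norm x.
Proof. by move=> Uiso; rewrite !euclid_norm_dotp isometry_dotp. Qed.

End Sphere.

(** * A Lebesgue number for unequal coset sums *)

Section Lebesgue.
Variables (R : realType) (p alpha k d n : nat).
Hypothesis p_pr : prime p.
Local Notation F := 'F_p.
Local Notation G := {ffun 'I_alpha -> F}.
Variables (rho : G -> 'M[R]_k) (x0 : 'cV[R]_k) (f : 'cV[R]_n -> 'cV[R]_d).
Hypothesis rho_iso : forall g, isometric (rho g).
Hypothesis x0_sphere : euclid_norm x0 = 1.
Hypothesis f_cont : {within @sphere R n, continuous f}.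

Definition orbit_value (U : 'M[R]_(n, k)) (j : 'I_d) (g : G) : R :=
  f (U *m rho g *m x0) j 0.

(* The sign makes the maximiser of [coset_sum cj (U *m rho g)] the translate by
   [+ chi cj.1 g] of that of [coset_sum cj U]. *)
Definition coset_sum (cj : G * 'I_d) U (a : F) : R :=
  fiber_sum (orbit_value U cj.2) cj.1 (- a).

Lemma orbit_value_continuous U e : isometric U -> 0 < e ->
  exists2 r : R, 0 < r & forall V, isometric V -> `|V - U| < r ->
    forall j g, `|orbit_value V j g - orbit_value U j g| < e.
Proof.
move=> Uiso e_gt0.
have in_sphere (V : 'M[R]_(n, k)) g : isometric V -> sphere (V *m rho g *m x0).
  by move=> Viso; rewrite /sphere /= -mulmxA !isometry_euclid_norm.
pose close g (V : 'M[R]_(n, k)) := isometric V ->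
  forall j, `|orbit_value V j g - orbit_value U j g| < e.
have near_g g : \forall V \near nbhs U, close g V.
  have := in_sphere U g Uiso; move/subspace_continuousP: f_cont => f_c /f_c.
  move=> /cvgrPdist_lt /(_ e e_gt0) /nbhs_ballP[r /= r_gt0 r_ball].
  pose M := k%:R * `|rho g *m x0| + 1.
  have M_gt0 : 0 < M by rewrite ltr_wpDl ?mulr_ge0 ?ler0n.
  apply/nbhs_ballP; exists (r / M); first by rewrite /= divr_gt0.
  move=> V; rewrite -ball_normE /ball_ /= => lt_r Viso j.
  have: ball (U *m rho g *m x0) r (V *m rho g *m x0).
    rewrite -ball_normE /ball_ /= -!mulmxA -mulmxBl (le_lt_trans (mx_norm_mul _ _)) //.
    move: lt_r; rewrite ltr_pdivlMr //; apply: le_lt_trans.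
    by rewrite mulrAC mulrC ler_wpM2l // lerDl.
  move=> /r_ball /(_ (in_sphere V g Viso)); apply: le_lt_trans.
  by rewrite distrC; apply: le_trans (le_mx_norm _ j 0); rewrite !mxE.
have := @filter_forall _ G close (nbhs U) (nbhs_filter U) near_g.
move=> /nbhs_ballP[r /= r_gt0 r_ball]; exists r => // V Viso lt_r j g.
by apply: r_ball => //; rewrite -ball_normE /ball_ /= distrC.
Qed.

Hypothesis not_const : forall U, isometric U ->
  exists g h j, orbit_value U j g != orbit_value U j h.

Definition separating cj a b U r := forall V, isometric V -> `|V - U| < r ->
  coset_sum cj V a < coset_sum cj V b.

(** By [fiber_sums_const_eq] some hyperplane has unequal coset sums at [U], and a strict inequality
    persists nearby. *)
Lemma separating_local U : isometric U -> exists2 r : R, 0 < r &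
  exists cj a b, cj \in char_index p alpha d alpha /\ separating cj a b U r.
Proof.
move=> Uiso.
have [cj [a [b [cj_in lt_ab]]]] : exists cj a b,
    cj \in char_index p alpha d alpha /\ coset_sum cj U a < coset_sum cj U b.
  have [g [h [j neq_gh]]] := not_const Uiso.
  apply: contrapT => no_cj; case/eqP: neq_gh.
  apply: (@fiber_sums_const_eq p alpha p_pr R (orbit_value U j)).
  move=> m c a b lt_m c_m; apply: contrapT => /eqP; rewrite neq_lt => /orP[] lt_ab.
    apply: no_cj; exists (c, j), (- a), (- b); rewrite /coset_sum /= !opprK.
    split=> //; rewrite mem_char_index; apply/existsP.
    by exists (Ordinal lt_m).
  apply: no_cj; exists (c, j), (- b), (- a); rewrite /coset_sum /= !opprK.
  split=> //; rewrite mem_char_index; apply/existsP.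
  by exists (Ordinal lt_m).
pose gap := coset_sum cj U b - coset_sum cj U a.
have gap_gt0 : 0 < gap by rewrite subr_gt0.
(* An error of [e] in each of the |G| orbit values moves a coset sum by at most a third of the
   gap. *)
pose e := gap / (3 * #|{: G}|%:R).
have card_gt0 : 0 < #|{: G}|%:R :> R by rewrite ltr0n; apply/card_gt0P; exists 0.
have e_gt0 : 0 < e by rewrite divr_gt0 // mulr_gt0.
have [r r_gt0 r_close] := orbit_value_continuous Uiso e_gt0.
exists r => //; exists cj, a, b; split=> // V Viso lt_r.
have sum_close t : `|coset_sum cj V t - coset_sum cj U t| <= gap / 3.
  have -> : gap / 3 = \sum_(g : G) e.
    by rewrite sumr_const -mulr_natl /e; field; rewrite gt_eqF.
  rewrite /coset_sum /fiber_sum -sumrB (le_trans (ler_norm_sum _ _ _)) //.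
  rewrite [leRHS](bigID (fun g => chi cj.1 g == - t)) /= ler_wpDr //.
    by rewrite sumr_ge0 // => g _; rewrite ltW.
  by apply: ler_sum => g _; rewrite ltW // r_close.
have := sum_close a; have := sum_close b; rewrite !ler_distl.
by move: gap_gt0; rewrite /gap; lra.
Qed.

(** Half of a local radius serves for all isometries in the ball of half that radius; compactness
    then gives a common one. *)
Lemma separating_uniform : exists2 r : R, 0 < r & forall U, isometric U ->
  exists cj a b, cj \in char_index p alpha d alpha /\ separating cj a b U r.
Proof.
pose P (r : R) U := exists cj a b, cj \in char_index p alpha d alpha /\ separating cj a b U r.
have : \forall r \near 0^'+, [set U | isometric U] `<=` P r.
  apply: (iffLR (compact_near_coveringP _) (@stiefel_compact R n k)).
  move=> U Uiso; have [r r_gt0 [cj [a [b [cj_in sep]]]]] := separating_local Uiso.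
  exists (ball U (r / 2), [set s | s < r / 2]).
    split => /=; first by apply: nbhsx_ballx; rewrite divr_gt0.
    by apply: nbhs_right_lt; rewrite divr_gt0.
  move=> [V s] /= [V_ball s_lt]; exists cj, a, b; split=> // W Wiso lt_s.
  apply: sep => //; move: V_ball; rewrite -ball_normE /ball_ /= distrC => V_lt.
  rewrite -(subrK V W) -addrA (le_lt_trans (ler_normD _ _)) //.
  by rewrite [ltRHS](splitr r) ltrD // (lt_trans lt_s).
move=> near0; near (0 : R)^'+ => r.
exists r; first by near: r; apply: nbhs_right_gt.
by move=> U Uiso; apply: (near near0 r).
Unshelve. all: end_near. Qed.

End Lebesgue.

(** * Proof of the theorem *)

Lemma geometric_small (R : realType) N (C delta : R) : 0 < delta ->
  exists r, (N%:R / N.+1%:R) ^+ r * C <= delta.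
Proof.
move=> delta_gt0; set kappa := _ / _.
have kappa_ge0 : 0 <= kappa by rewrite divr_ge0 ?ler0n.
have kappa_lt1 : `|kappa| < 1.
  by rewrite ger0_norm // ltr_pdivrMr ?ltr0n // mul1r ltr_nat.
have C1_gt0 : 0 < `|C| + 1 by rewrite ltr_wpDl.
have := cvg_expr kappa_lt1; move=> /cvgrPdist_lt /(_ (delta / (`|C| + 1))).
rewrite divr_gt0 // => /(_ isT)[r _ /(_ r (leqnn r))] /=.
rewrite sub0r normrN ger0_norm ?exprn_ge0 // => lt_r; exists r.
rewrite (le_trans (ler_wpM2l _ (ler_norm C))) ?exprn_ge0 //.
apply: (@le_trans _ _ (kappa ^+ r * (`|C| + 1))).
  by rewrite ler_wpM2l ?exprn_ge0 // lerDl.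
by rewrite -ler_pdivlMr // ltW.
Qed.

Section IterConeOp.
Variables (F : comNzRingType) (P : Type) (b : seq P -> P).
Implicit Types phi psi : seq P -> F.

Lemma iter_cone_opB r phi psi :
  iter r (cone_op b) (fun s => phi s - psi s) =
  fun s => iter r (cone_op b) phi s - iter r (cone_op b) psi s.
Proof.
by elim: r => //= r ->; apply/funext => s; rewrite cone_opB.
Qed.

Lemma iter_cone_op_cobd r phi :
  iter r (cone_op b) (cobd phi) = cobd (iter r (cone_op b) phi).
Proof. by elim: r => //= r ->; apply/funext => s; rewrite cone_op_cobd. Qed.

Lemma iter_cone_op_nil r phi : iter r (cone_op b) phi [::] = phi [::].
Proof. by elim: r. Qed.

Lemma iter_cone_op_equivariant h r phi s :
  (forall x u, b (map h (x :: u)) = h (b (x :: u))) ->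
  iter r (cone_op b) phi (map h s) = iter r (cone_op b) (fun t => phi (map h t)) s.
Proof.
move=> bh; elim: r s => //= r IHr s; rewrite (cone_op_equivariant (h' := h)) //.
by congr cone_op; apply/funext => t; apply: IHr.
Qed.

End IterConeOp.

Lemma mem_flag (T : Type) (P : eqType) (pt : nat -> T -> P) (g : nat -> T) m x :
  x \in flag pt g m -> exists2 l : 'I_m, true & x = pt l (g l).
Proof.
elim: m => //= m IHm; rewrite inE => /orP[/eqP->|/IHm[l _ ->]].
  by exists ord_max.
by exists (widen_ord (leqnSn m) l).
Qed.

HB.instance Definition _ (T : finType) (V : finZmodType) := Finite.on {ffun T -> V}.

Section ConstantOnCopy.
Variables (R : realType) (p alpha k d n : nat).
Hypothesis p_pr : prime p.
Hypotheses (alpha_gt0 : (0 < alpha)%N) (d_gt0 : (0 < d)%N).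
Local Notation F := 'F_p.
Local Notation G := {ffun 'I_alpha -> F}.
Variables (rho : G -> 'M[R]_k) (x0 : 'cV[R]_k) (f : 'cV[R]_n -> 'cV[R]_d).
Hypothesis rho0 : rho 0 = 1%:M.
Hypothesis rhoD : forall g h, rho (g + h) = rho g *m rho h.
Hypothesis rho_orth : forall g, orthogonal_mx (rho g).
Hypothesis x0_sphere : euclid_norm x0 = 1.
Hypothesis le_dim : (d * (#|{: G}| - 1) + k <= n)%N.
Hypothesis f_cont : {within @sphere R n, continuous f}.

Local Notation index := (char_index p alpha d alpha).
Local Notation N := (size index * p.-1)%N.
Local Notation point := ('M[R]_(n, k) * G)%type.

Let rho_iso g : isometric (rho g).
Proof. exact: mulmx1C (rho_orth g). Qed.

Let rho_le g : `|rho g| <= 1.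
Proof. by apply: mx_norm_le => // i j; apply: isometry_entry_le. Qed.

Let le_Nk : (N + k <= n)%N.
Proof.
apply: leq_trans le_dim; rewrite leq_add2r card_ffun card_Fp // card_ord.
exact: size_char_index.
Qed.

Let le_kn : (k <= n)%N.
Proof. exact: leq_trans (leq_addl _ _) le_Nk. Qed.

Lemma coset_sum_act cj (U : 'M[R]_(n, k)) g a :
  coset_sum rho x0 f cj (U *m rho g) a = coset_sum rho x0 f cj U (a - chi cj.1 g).
Proof.
rewrite /coset_sum /fiber_sum [RHS](reindex (+%R g)) /=; last first.
  by exists (+%R (- g)) => h _; rewrite ?addKr ?addNKr.
apply: eq_big => [h|h _]; last by rewrite /orbit_value rhoD mulmxA.
by rewrite chiD opprB -(inj_eq (addrI (chi cj.1 g))).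
Qed.

(** The second component makes the action free, even at the matrix 0, which is used for the
    comparison chain map. *)
Definition act g (x : point) : point := (x.1 *m rho g, g + x.2).

Section Labels.
Variable polar_of : 'M[R]_(n, k) -> 'M[R]_(n, k).
Hypothesis polar_ofP : forall A, polar A (polar_of A).

Definition best cj (U : 'M[R]_(n, k)) : F :=
  [arg max_(a > 0) coset_sum rho x0 f cj U a]%O.

Lemma bestP cj U a : coset_sum rho x0 f cj U a <= coset_sum rho x0 f cj U (best cj U).
Proof. by rewrite /best; case: arg_maxP => // b _; apply. Qed.

(* Twisting by the second component of [x] makes [label] equivariant whatever the
   choices made by [polar_of] and [best]. *)
Definition label cj (x : point) : F :=
  chi cj.1 x.2 + best cj (polar_of (x.1 *m rho (- x.2))).

Lemma label_act cj g x : label cj (act g x) = chi cj.1 g + label cj x.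
Proof.
rewrite /label /= chiD -addrA; congr (_ + (_ + best _ (polar_of _))).
by rewrite -mulmxA -rhoD opprD addrA subrr add0r.
Qed.

Lemma label_base cj g :
  label cj (0, g) = best cj (polar_of 0) + chi cj.1 g.
Proof. by rewrite /label /= mul0mx addrC. Qed.

Definition good (c C : R) (A : 'M[R]_(n, k)) :=
  `|A| <= C /\ forall w : 'cV[R]_k, c * `|w| <= `|A *m w|.

(** Points with close matrices have polar factors within [r] of a single one. There the value [a]
    given by [separating] never maximises the coset sum, so the label for [cj] misses [a]. *)
Lemma label_small c C r : 0 < c -> 0 <= C -> 0 < r ->
  (forall U, isometric U -> exists cj a b,
     cj \in index /\ separating rho x0 f cj a b U r) ->
  exists2 delta, 0 < delta & forall s : seq point, size s = N.+1 ->
    (forall x, x \in s -> good c C x.1) -> diam_le delta s ->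
    cup_labels [seq label cj | cj <- index] s = 0.
Proof.
move=> c_gt0 C_ge0 r_gt0 sep.
have mod_gt0 : 0 < @polar_mod R n k c C.
  rewrite divr_gt0 ?exprn_gt0 // mulr_gt0 ?ltr0n // ltr_wpDl //.
  by rewrite !mulr_ge0 ?ler0n // sqr_ge0.
have nk_gt0 : 0 < n%:R * k%:R + 1 :> R by rewrite ltr_wpDl // mulr_ge0 ?ler0n.
exists (r * polar_mod n k c C / (n%:R * k%:R + 1)).
  by rewrite divr_gt0 // mulr_gt0.
move=> [|x1 s] // sz_s s_good s_diam.
have [iso1 _] := polar_ofP x1.1.
have [cj [a [b [cj_in cj_sep]]]] := sep _ iso1.
apply: (@cup_labels_avoid p p_pr _ _ (label cj) a).
- exact: mem_In_map.
- by rewrite size_map.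
move=> x x_s; apply/eqP => label_a.
(* [V] is a polar factor of [x.1] itself, and [label cj x] maximises its coset sum. *)
pose V := polar_of (x.1 *m rho (- x.2)) *m rho x.2.
have polarV : polar x.1 V.
  have := polar_mul (rho_orth x.2) (rho_iso x.2) (polar_ofP (x.1 *m rho (- x.2))).
  by rewrite -mulmxA -rhoD addNr rho0 mulmx1.
have [x_le x_ge] := s_good x x_s; have [x1_le x1_ge] := s_good x1 (mem_head _ _).
have := polar_lipschitz c_gt0 C_ge0 x_le x1_le x_ge x1_ge polarV (polar_ofP x1.1).
move=> lip; have : `|V - polar_of x1.1| < r.
  rewrite -(ltr_pM2l mod_gt0) (le_lt_trans lip) //.
  apply: (@le_lt_trans _ _ (n%:R * k%:R * (r * polar_mod n k c C / (n%:R * k%:R + 1)))).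
    by rewrite ler_wpM2l ?mulr_ge0 ?ler0n // s_diam // mem_head.
  rewrite [ltRHS]mulrC; have : 0 < r * polar_mod n k c C by rewrite mulr_gt0.
  move: (r * _) => q q_gt0; rewrite mulrCA -[ltRHS]mulr1 ltr_pM2l //.
  by rewrite ltr_pdivrMr // mul1r ltrDl.
move=> /(cj_sep _ (polarV.1)); apply/negP; rewrite -leNgt.
rewrite !coset_sum_act -label_a /label addrAC subrr add0r.
exact: bestP.
Qed.

End Labels.

Theorem constant_on_copy : exists U : 'M[R]_(n, k), isometric U /\
  forall g, f (U *m rho g *m x0) = f (U *m x0).
Proof.
apply: contrapT => no_U.
have not_const (U : 'M[R]_(n, k)) : isometric U ->
    exists g h j, orbit_value rho x0 f U j g != orbit_value rho x0 f U j h.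
  move=> Uiso; apply: contrapT => no_ghj; apply: no_U; exists U; split=> // g.
  apply/matrixP => j i; rewrite (ord1 i); apply/eqP; apply: contrapT => /negP neq.
  by apply: no_ghj; exists g, 0, j; rewrite /orbit_value rho0 mulmx1.
have [polar_of polar_ofP] := choice (fun A => @polar_exists R n k A le_kn).
have [r r_gt0 sep] := separating_uniform p_pr rho_iso x0_sphere f_cont not_const.
have [|A [c [A_le c_gt0 A_ok]]] := @general_position R n k G rho rho0 rhoD rho_le N.+1.
  by rewrite addnS ltnS addnC.
have C_ge0 : 0 <= k%:R :> R by rewrite ler0n.
have [delta delta_gt0 small] := label_small polar_ofP c_gt0 C_ge0 r_gt0 sep.
(* The matrices [A l *m rho g] have norm at most k, so 2 k bounds the diameter of every flag. *)
have [r0 r0_small] := geometric_small N (2 * k%:R) delta_gt0.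
set lab := [seq label polar_of cj | cj <- index] in small.
(* Restricting the cup product to one degree makes its coboundary vanish on sequences of every
   size. *)
pose phi (s : seq point) := if size s == N.+1 then cup_labels lab s else 0.
have phi_cocycle : cobd phi = fun=> 0.
  apply/funext => -[|x s] //; have [sz_s|sz_s] := eqVneq (size s) N.+1.
    rewrite (@eq_cobd_size _ _ _ (cup_labels lab) N.+1) ?sz_s //.
    - by apply: cup_labels_cocycle; rewrite size_map /= sz_s.
    - by move=> t sz_t; rewrite /phi sz_t eqxx.
    by rewrite /= sz_s.
  rewrite -[RHS](cobd0 _ (x :: s)); apply: (@eq_cobd_size _ _ _ _ (size s)) => // t sz_t.
  by rewrite /phi sz_t (negbTE sz_s).
pose pt l (g : G) : point := (A l *m rho g, g).
pose b := flag_point pt 0.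
pose Sd (psi : seq point -> F) :=
  iter r0 (cone_op (@barycenter R 'M[R]_(n, k) G)) psi.
(* Two equivariant chain maps on tuples in G are compared: flags of general position matrices,
   subdivided [r0] times, and tuples with matrix 0. *)
pose D psi (t : seq G) : F := cone_op b (Sd psi) t - psi [seq (0, g) | g <- t].
have D_sub psi psi' t : D (fun s => psi s - psi' s) t = D psi t - D psi' t.
  by rewrite /D /Sd iter_cone_opB cone_opB; ring.
have D_cobd psi t : D (cobd psi) t = cobd (D psi) t.
  by rewrite /D /Sd iter_cone_op_cobd cone_op_cobd cobdB cobd_map.
have D_nil psi : D psi [::] = 0 by rewrite /D cone_op_nil /Sd iter_cone_op_nil subrr.
have D_act g psi t : D psi [seq g + x | x <- t] = D (fun s => psi (map (act g) s)) t.
  have b_act x u : b (map (+%R g) (x :: u)) = act g (b (x :: u)).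
    by rewrite /b /flag_point /pt /act /= size_map addrC rhoD mulmxA addrC.
  have bary_act (x : point) u :
      barycenter (map (act g) (x :: u)) = act g (barycenter (x :: u)).
    congr (_, _); rewrite -[RHS]/(mean (map fst (x :: u)) *m rho g) -map_comp.
    by rewrite /mean !size_map -scalemxAl !big_map mulmx_suml.
  rewrite /D (cone_op_equivariant (h' := act g)) // -!map_comp; congr (_ - psi _).
    congr cone_op; apply/funext => s; rewrite /Sd.
    exact: (iter_cone_op_equivariant (h := act g)).
  by apply: eq_map => x; rewrite /= /act /= mul0mx.
(* General position keeps the convex hull of a flag within the [good] matrices, so [label_small]
   applies to its small subdivided simplices. *)
have cone0 t : size t = N.+1 -> cone_op b (Sd phi) t = 0.
  move=> sz_t; apply: cone_flag_eq0 => g; rewrite sz_t.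
  pose B (l : 'I_N.+1) := A l *m rho (g l).
  pose Z (v : 'M[R]_(n, k)) := exists t : 'I_N.+1 -> R,
    [/\ forall l, 0 <= t l, \sum_l t l = 1 & v = \sum_l t l *: B l].
  have B_le l : `|B l| <= k%:R.
    rewrite (le_trans (mx_norm_mul _ _)) // -mulrA ler_piMr ?ler0n //.
    by rewrite mulr_ile1.
  have Z_good v : Z v -> good c k%:R v.
    move=> [tt [tt_ge0 tt_sum ->]]; split=> [|w].
      have <- : \sum_l tt l * k%:R = k%:R by rewrite -big_distrl /= tt_sum mul1r.
      rewrite (le_trans (ler_norm_sum _ _ _)) //.
      by apply: ler_sum => l _; rewrite normrZ ger0_norm // ler_wpM2l.
    pose t' (l : nat) := if (l < N.+1)%N then tt (inord l) else 0.
    have t'E (l : 'I_N.+1) : t' l = tt l by rewrite /t' ltn_ord inord_val.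
    have t'_ge0 l : 0 <= t' l by rewrite /t'; case: ifP.
    have := A_ok g t' w t'_ge0.
    rewrite (eq_bigr tt) => [|l _]; last exact: t'E.
    rewrite tt_sum mulr1 (eq_bigr (fun l => tt l *: B l)) // => l _.
    by rewrite t'E.
  have flag_Z x : x \in flag pt g N.+1 -> Z x.1.
    move=> /mem_flag[l _ ->]; exists (fun l' => (l' == l)%:R); split=> [l'||].
    - by rewrite ler0n.
    - by rewrite (bigD1 l) //= eqxx big1 ?addr0 // => l' /negbTE->.
    - rewrite (bigD1 l) //= eqxx scale1r big1 ?addr0 // => l' /negbTE->.
      by rewrite scale0r.
  apply: (@iter_subdivision_eq0 _ _ _ _ r0 N phi _ Z (2 * k%:R)).
  - exact: convex_hull_mean_closed.
  - exact: size_flag.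
  - by rewrite mulr_ge0.
  - move=> x y /flag_Z/Z_good[x_le _] /flag_Z/Z_good[y_le _].
    by rewrite (le_trans (ler_normB _ _)) // mulr_natl mulr2n lerD.
  - exact: flag_Z.
  move=> s sz_s s_Z s_diam; rewrite /phi sz_s eqxx; apply: small => //.
    by move=> x /s_Z/Z_good.
  by move=> x y x_s y_s; rewrite (le_trans (s_diam _ _ x_s y_s)).
pose q (g : G) : point := (0, g).
have q_act g x : q (g + x) = act g (q x) by rewrite /q /act /= mul0mx.
have phi_act g : (fun s => phi (map (act g) s)) = phi.
  apply/funext => s; rewrite /phi size_map; case: ifP => // _.
  by apply: eq_cup_labels_shift => cj x; apply: label_act.
have adm := @char_levels_admissible p alpha d d_gt0 alpha (leqnn alpha).
(* As the first chain map kills [phi], the homotopy shows that minus the pullback by the second is a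
   coboundary, whence the factor -1. That pullback is the cup product of the characters, up to
   constants that translation invariance removes. *)
apply: (@cup_labels_not_cobd p p_pr _ _ (fun t => -1 * htpy D q phi t) adm).
- rewrite labels_char_levels size_map muln_gt0 size_char_index_gt0 //.
  by rewrite -ltnS prednK ?prime_gt0 ?prime_gt1.
- move=> g t; congr (_ * _).
  by rewrite (htpy_equivariant (h' := act g)) // phi_act.
rewrite labels_char_levels size_map => t sz_t; rewrite cobdZ.
have := htpyP D_sub D_cobd D_nil q phi t.
rewrite phi_cocycle htpy0 // addr0 => <-.
rewrite /D cone0 // sub0r mulN1r opprK /phi size_map sz_t eqxx.
by rewrite (eq_cup_labels_translate _ _ (label_base polar_of)).
Qed.

End ConstantOnCopy.

(* ['F_p] is ['Z_(pdiv p)], equal but not convertible to ['Z_p]. *)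
Lemma constant_on_copy_Zp (R : realType) (q p alpha k d n : nat)
  (rho : {ffun 'I_alpha -> 'Z_q} -> 'M[R]_k) (x0 : 'cV[R]_k)
  (f : 'cV[R]_n -> 'cV[R]_d) :
  prime p -> pdiv p = q -> (0 < alpha)%N -> (0 < d)%N ->
  orth_action rho -> euclid_norm x0 = 1 ->
  (d * (#|{: {ffun 'I_alpha -> 'Z_q}}| - 1) + k <= n)%N ->
  {within @sphere R n, continuous f} ->
  exists U : 'M[R]_(n, k), isometric U /\
    forall g, f (U *m rho g *m x0) = f (U *m x0).
Proof.
move=> p_pr Eq; case: q / Eq rho => rho alpha_gt0 d_gt0 [rho0 [rhoD rho_orth]].
exact: constant_on_copy.
Qed.

Theorem theorem1 (R : realType) (p alpha k d n : nat)
  (rho : {ffun 'I_alpha -> 'Z_p} -> 'M[R]_k) (X : set 'cV[R]_k)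
  (f : 'cV[R]_n -> 'cV[R]_d) :
  prime p -> (1 <= alpha)%N ->
  orth_action rho ->
  X `<=` @sphere R k ->
  (exists x0 : 'cV[R]_k, X = orbit_of rho x0) ->
  (1 <= d)%N ->
  (d * (#|{: {ffun 'I_alpha -> 'Z_p}}| - 1) + k <= n)%N ->
  {within @sphere R n, continuous f} ->
  exists (X' : set 'cV[R]_n) (e : 'cV[R]_k -> 'cV[R]_n),
    [/\ X' `<=` @sphere R n,
        set_bij X X' e,
        (forall x y, X x -> X y -> euclid_dist (e x) (e y) = euclid_dist x y)
      & (forall u v, X' u -> X' v -> f u = f v)].
Proof.
move=> p_pr alpha_gt0 rho_act X_sphere [x0 defX] d_gt0 le_dim f_cont.
have x0_sphere : euclid_norm x0 = 1.
  apply: X_sphere; rewrite defX; exists 0 => //.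
  by rewrite (proj1 rho_act) mul1mx.
have [U [Uiso U_const]] :=
  constant_on_copy_Zp p_pr (pdiv_id p_pr) alpha_gt0 d_gt0
    rho_act x0_sphere le_dim f_cont.
exists [set U *m x | x in X], (mulmx U); split.
- by move=> _ [x /X_sphere x1 <-]; rewrite /sphere /= isometry_euclid_norm.
- split=> [x Xx|x y _ _ Exy|//]; first by exists x.
  by rewrite -[x]mul1mx -[y]mul1mx -Uiso -!mulmxA Exy.
- by move=> x y _ _; rewrite /euclid_dist -mulmxBr isometry_euclid_norm.
have f_copy u : [set U *m x | x in X] u -> f u = f (U *m x0).
  by move=> [x Xx <-]; move: Xx; rewrite defX => -[g _ <-]; rewrite mulmxA.
by move=> u v /f_copy-> /f_copy->.
Qed.
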